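(* Let $G$ be a graph of order $n$ and size $m$. Assume that $G$ is neither complete nor co-complete and let $c$ be an integer number such that $4\leq c\leq n-4$. If $\ell_\star$ and $u^\star$ are integers such that $0\leq \ell_\star\leq \ell(c)\leq u(c)\leq u^\star$, then $G$ has a subgraph of order $c$ whose size is at least $$\left\lceil\min\left\{\frac{2S_2(c)}{S_1(c)}+1,\;S_1(c)+\frac{\sigma^2(c)}{S_1(c)-\ell_\star}\right\}\right\rceil$$ and a subgraph of order $c$ whose size is at most $$\left\lfloor S_1(c)-\frac{\sigma^2(c)}{u^\star-S_1(c)}\right\rfloor,$$ where $\sigma^2(c)=2S_2(c)-S_1(c)(S_1(c)-1)$ and $\ell(c)$ and $u(c)$ are the minimum and the maximum of the values attained with positive probability by $M_c(G)$. The lower and upper bounds are attained precisely by the following graphs, when $\ell_\star=\ell(c)$ and $u^\star=u(c)$, respectively: a star, the disjoint union of an edge and $n-2$ vertices, or the complement of such graphs. We can always choose $\gamma_c$ for $u^\star$ and $c-\alpha^\star$ for $\ell_\star$, where $\alpha^\star$ is any upper bound on the independence number of $G$. Moreover, given $u^\star$ and $\ell_\star$, the bounds can be computed in time linear in the size of $G$.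
   Context: Graphs are simple; the order of a graph is its number of vertices and its size is its number of edges. A graph is co-complete if it is the complement of a complete graph. Subgraphs of order $c$ here are the subgraphs induced by sets of $c$ vertices. $M_c(G)$ is the random variable defined as the size of the subgraph of $G$ induced by a uniformly random set of $c$ vertices of $G$. Its first two binomial moments are $S_1(c)=\mathbb{E}(M_c(G))$ and $S_2(c)=\frac12\mathbb{E}\big(M_c(G)(M_c(G)-1)\big)$, and $\sigma^2(c)$ is its variance. The number $\gamma_c$ is $\lfloor c/2\rfloor\lceil c/2\rceil$ (the size of the balanced complete bipartite graph on $c$ vertices) if $G$ is bipartite, and $\frac{c(c-1)}{2}$ (the size of the complete graph on $c$ vertices) otherwise.
   Formalization: Attainment concerns unrounded bounds. With min, complements fail (complement of a star, n=8, c=4: min is 5, u(c)=6), so the full list of graphs is proved with max in place of min; for min itself, attainment is shown to hold exactly for a star or a single edge plus isolated vertices. *)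

(* Defs.v *)
From mathcomp Require Import all_boot all_order all_algebra.

Set Implicit Arguments.
Unset Strict Implicit.
Unset Printing Implicit Defensive.

Import Order.TTheory GRing.Theory Num.Theory.
Local Open Scope ring_scope.

Record graph (T : finType) := Graph {
  adj :> rel T;
  adj_sym : symmetric adj;
  adj_irr : irreflexive adj
}.

Section Graphs.
Variables (T : finType) (G : graph T).

Definition compl_adj : rel T := [rel x y | (x != y) && ~~ G x y].

Lemma compl_sym : symmetric compl_adj.
Proof. by move=> x y; rewrite /compl_adj /= [x == y]eq_sym [G x y]adj_sym. Qed.

Lemma compl_irr : irreflexive compl_adj.
Proof. by move=> x; rewrite /compl_adj /= eqxx. Qed.

Definition compl : graph T := Graph compl_sym compl_irr.

Definition edges : {set {set T}} :=
  [set e | [exists x, exists y, G x y && (e == [set x; y])]].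

Definition gsize : nat := #|edges|.

(* The size of the subgraph induced by A. *)
Definition size_in (A : {set T}) : nat := #|[set e in edges | e \subset A]|.

Definition complete : Prop := forall x y : T, x != y -> G x y.

Definition is_star : Prop :=
  exists z : T, forall x y : T, G x y = (x != y) && ((x == z) || (y == z)).

Definition is_single_edge : Prop :=
  exists a b : T, a != b /\
    forall x y : T, G x y = (x == a) && (y == b) || (x == b) && (y == a).

Definition bipartite : bool :=
  [exists A : {set T}, forall x, forall y, G x y ==> ((x \in A) != (y \in A))].

Definition independent (A : {set T}) : bool :=
  [forall x in A, forall y in A, ~~ G x y].

Definition independence_number : nat :=
  (\max_(A : {set T} | independent A) #|A|)%N.

End Graphs.

Definition cocomplete (T : finType) (G : graph T) : Prop := complete (compl G).

Definition extremal (T : finType) (G : graph T) : Prop :=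
  [\/ is_star G, is_single_edge G, is_star (compl G)
    | is_single_edge (compl G)].

Section Moments.
Variables (T : finType) (G : graph T) (c : nat).

(* Expectation with respect to a uniformly random set of c vertices; it is
   meaningful for c <= #|T|. *)
Definition expect (f : {set T} -> rat) : rat :=
  (\sum_(A : {set T} | #|A| == c) f A) / 'C(#|T|, c)%:R.

Definition M (A : {set T}) : rat := (size_in G A)%:R.

Definition S1 : rat := expect M.

Definition S2 : rat := 2%:R^-1 * expect (fun A => M A * (M A - 1)).

Definition variance : rat := expect (fun A => (M A - S1) ^+ 2).

Definition prob_size (k : nat) : rat :=
  expect (fun A => (size_in G A == k)%:R).

(* 'C(c, 2) bounds every possible value, so it is neutral for the minimum. *)
Definition min_size : nat :=
  \big[minn/'C(c, 2)]_(k < 'C(c, 2).+1 | 0 < prob_size k) (k : nat).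

Definition max_size : nat :=
  \big[maxn/0%N]_(k < 'C(c, 2).+1 | 0 < prob_size k) (k : nat).

Definition gamma : nat :=
  if bipartite G then (c./2 * uphalf c)%N else 'C(c, 2).

(* For 0 <= ls < S1 the minimum below is always its first term, which is
   S1 + variance / S1 (the second term with ls = 0), and the maximum is always
   the second term. *)
Definition lower_min (ls : int) : rat :=
  Num.min (2%:R * S2 / S1 + 1) (S1 + variance / (S1 - ls%:~R)).

Definition lower_max (ls : int) : rat :=
  Num.max (2%:R * S2 / S1 + 1) (S1 + variance / (S1 - ls%:~R)).

Definition upper (us : int) : rat := S1 - variance / (us%:~R - S1).

Definition has_subgraph_ge (z : int) : Prop :=
  exists A : {set T}, #|A| = c /\ z <= (size_in G A)%:Z.

Definition has_subgraph_le (z : int) : Prop :=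
  exists A : {set T}, #|A| = c /\ (size_in G A)%:Z <= z.

End Moments.

(* Running time is measured on a word RAM, presented as a small structured
   language: memory cells are indexed by integers and hold integers, every
   instruction and every test costs one step, and every integer written to
   memory must be at most W in absolute value. *)
Definition mem := int -> int.

Definition upd (s : mem) (a v : int) : mem := fun b => if b == a then v else s b.

Inductive binop := Add | Sub | Mul | Div.

(* Div is Euclidean division, i.e. the floor of the quotient for a positive
   divisor. *)
Definition eval_binop (o : binop) (x y : int) : int :=
  match o with
  | Add => x + y
  | Sub => x - y
  | Mul => x * y
  | Div => (x %/ y)%Z
  end.

Inductive cmd :=
| Const of int & int               (* s[a] := v *)
| Op of binop & int & int & int    (* s[a] := s[b] o s[d] *)
| Read of int & int                (* s[a] := s[s[b]] *)
| Write of int & int               (* s[s[a]] := s[b] *)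
| Seq of cmd & cmd
| If of int & cmd & cmd            (* if 0 < s[a] *)
| While of int & cmd.              (* while 0 < s[a] *)

(* exec W p s t s': from memory s, p halts after t steps in memory s'. *)
Inductive exec (W : nat) : cmd -> mem -> nat -> mem -> Prop :=
| ExConst a v (s : mem) :
    (`|v| <= W)%N -> exec W (Const a v) s 1 (upd s a v)
| ExOp o a b d (s : mem) :
    (`|eval_binop o (s b) (s d)| <= W)%N ->
    exec W (Op o a b d) s 1 (upd s a (eval_binop o (s b) (s d)))
| ExRead a b (s : mem) :
    (`|s (s b)| <= W)%N -> exec W (Read a b) s 1 (upd s a (s (s b)))
| ExWrite a b (s : mem) :
    (`|s b| <= W)%N -> exec W (Write a b) s 1 (upd s (s a) (s b))
| ExSeq p q (s : mem) t (s' : mem) t' (s'' : mem) :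
    exec W p s t s' -> exec W q s' t' s'' -> exec W (Seq p q) s (t + t')%N s''
| ExIfT a p q (s : mem) t (s' : mem) :
    0 < s a -> exec W p s t s' -> exec W (If a p q) s t.+1 s'
| ExIfF a p q (s : mem) t (s' : mem) :
    s a <= 0 -> exec W q s t s' -> exec W (If a p q) s t.+1 s'
| ExWhileF a p (s : mem) : s a <= 0 -> exec W (While a p) s 1 s
| ExWhileT a p (s : mem) t (s' : mem) t' (s'' : mem) :
    0 < s a -> exec W p s t s' -> exec W (While a p) s' t' s'' ->
    exec W (While a p) s (t + t').+1%N s''.

(* es lists every edge exactly once, with arbitrary order and orientation. *)
Definition edge_list (T : finType) (G : graph T) (es : seq (T * T)) : Prop :=
  perm_eq [seq [set e.1; e.2] | e <- es] (enum (edges G)).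

Definition input_words (T : finType) (G : graph T) (lab : T -> 'I_#|T|)
    (es : seq (T * T)) (c : nat) (ls us : int) : seq int :=
  [:: #|T|%:Z; (gsize G)%:Z; c%:Z; ls; us] ++
  flatten [seq [:: (lab e.1)%:Z; (lab e.2)%:Z] | e <- es].

(* The input occupies the first cells; the other cells are arbitrary. *)
Definition loaded (w : seq int) (s : mem) : Prop :=
  forall i : nat, (i < size w)%N -> s i%:Z = nth 0 w i.

(* Program p computes the (rounded) bounds for all graphs in at most
   K * gsize G steps, using words of O(log(#|T| + |us| + |ls|)) bits. *)
Definition computes_bounds (p : cmd) (K : nat) : Prop :=
  forall (T : finType) (G : graph T) (c : nat) (ls us : int)
    (lab : T -> 'I_#|T|) (es : seq (T * T)) (s : mem),
    ~ complete G -> ~ cocomplete G -> (4 <= c)%N -> (c <= #|T| - 4)%N ->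
    ls <= (min_size G c)%:Z -> (max_size G c)%:Z <= us ->
    injective lab -> edge_list G es -> loaded (input_words G lab es c ls us) s ->
    exists (t : nat) (s' : mem),
      [/\ exec ((#|T| + `|us| + `|ls|) ^ K)%N p s t s',
          (t <= K * gsize G)%N,
          s' 0 = Num.ceil (lower_min G c ls),
          s' 1 = Num.ceil (lower_max G c ls)
        & s' 2%:Z = Num.floor (upper G c us)].

(* Main.v *)
Require Import Defs.
From mathcomp Require Import all_boot all_order all_algebra.
From mathcomp Require Import zify ring.
(* All sizes M of induced subgraphs of order c lie between l and u, so
   0 <= E((M - a)(b - M)) = (S1 - a)(b - S1) - variance for a <= l and u <= b,
   which rearranges into the bounds. Equality forces M to take only the values
   l and u. Put d = u - l. Exchanging one vertex x for another vertex y changes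
   M by the sum of g(p) = [x ~ p] - [y ~ p] over the other c - 1 vertices, and
   this sum is always 0, d or -d. If d >= 3, comparing sums that differ in one
   vertex shows that g is constant, which leaves stars, their complements and
   trivial graphs. If d is 0 or 2, g vanishes and the graph is trivial. If
   d = 1, a vertex x with two neighbours that are not neighbours of y is
   impossible, so G or its complement is a matching, and two matching edges
   already give three sizes.

   The moments depend only on n, m, c and the sum of the squared degrees. A
   word RAM gets the latter in time O(m), even from dirty memory: a first pass
   over the edge list clears the counters of the vertices that occur in it, and
   a second pass counts, adding up the pairs of equal endpoints. *)

Set Implicit Arguments.
Unset Strict Implicit.
Unset Printing Implicit Defensive.
Import Order.TTheory GRing.Theory Num.Theory.
Local Open Scope ring_scope.

(** The range 4 <= c <= n - 4 is exactly what the exchanges consume: at most four vertices of a set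
    of order c are prescribed, and its other c - 4 vertices must avoid up to eight named ones.

    The values of g lie in {-1, 0, 1}, so two compared sums differ by at most 2. Two members of {0,
    d, -d} that close coincide if d = 0 or d >= 3, but not if d is 1 or 2; hence the separate
    arguments for these two gaps.

    The equality case of the lower bound splits. Since 2 S2 / S1 + 1 = S1 + variance / S1, the first
    term is the second with a = 0. Equality there asks for the sizes 0 and u, and an edgeless set of
    order c excludes the complements of stars and of edges. With a = l all four kinds of graphs
    occur.

    The strict inequalities l < S1 < u, which make the denominators positive, are themselves the
    case d = 0 of the structure theorem.

    In the algorithm, clearing a counter for every vertex would cost n steps, which m need not
    bound. The moments share the denominator n(n - 1)(n - 2)(n - 3), so each rounded bound is one
    integer division. *)

(** * Edge counts of vertex sets *)

Section GraphSizes.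
Variables (T : finType) (G : graph T).
Implicit Types (A B C : {set T}) (x y p q : T).

Lemma edgesP (e : {set T}) :
  reflect (exists x y, G x y /\ e = [set x; y]) (e \in edges G).
Proof.
rewrite inE; apply: (iffP existsP) => [[x /existsP[y /andP[xy /eqP->]]]|].
  by exists x, y.
by move=> [x [y [xy ->]]]; exists x; apply/existsP; exists y; rewrite xy eqxx.
Qed.

Lemma adj_neq x y : G x y -> x != y.
Proof. by apply: contraTneq => ->; rewrite adj_irr. Qed.

Lemma edges_set2 x y : ([set x; y] \in edges G) = G x y.
Proof.
apply/edgesP/idP => [[a [b [ab /setP E]]]|xy]; last by exists x, y.
have /orP[/eqP Da | /eqP Da]: (a == x) || (a == y) by have := E a; rewrite !inE eqxx.
  have := E b; rewrite !inE eqxx orbT -Da eq_sym (negbTE (adj_neq ab)) /=.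
  by move=> /eqP <-.
have := E b; rewrite !inE eqxx orbT -Da [b == a]eq_sym (negbTE (adj_neq ab)) orbF.
by move=> /eqP <-; rewrite adj_sym.
Qed.

Lemma card_edge (e : {set T}) : e \in edges G -> #|e| = 2.
Proof. by case/edgesP=> x [y [xy ->]]; rewrite cards2 (adj_neq xy). Qed.

Lemma set2_injr x : injective (fun p : T => [set x; p]).
Proof.
move=> p q /setP E; have := E p; have := E q; rewrite !inE !eqxx !orbT.
by case: (eqVneq p q) => // pq; rewrite !orbF => /eqP -> /esym /eqP ->.
Qed.

(** An edge inside [x |: B] either avoids [x] or is the image of a neighbour of [x] in [B] under the
    injection [p] to [[set x; p]]. All exchanges of vertices rest on this count. *)
Lemma size_inU1 x B : x \notin B ->
  size_in G (x |: B) = (size_in G B + \sum_(p in B) G x p)%N.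
Proof.
move=> xB; rewrite /size_in.
move: (edges G) edgesP edges_set2 => E EP E2.
rewrite -(cardsID [set e : {set T} | e \subset B]); congr addn.
  apply: eq_card => e; rewrite !inE -andbA; congr (_ && _).
  apply/andP/idP => [[] //|eB]; split=> //.
  by apply: subset_trans eB _; apply: subsetUr.
rewrite -big_mkcondr /= sum1_card -(card_imset _ (@set2_injr x)).
apply: eq_card => e; rewrite !inE.
apply/and3P/imsetP => [[neB /EP[a [b [ab De]]]]|[p]].
  move: neB; rewrite De !subUset !sub1set !inE.
  case: (eqVneq a x) ab De => [-> | ax] ab De; case: (eqVneq b x) ab De => [->|bx] ab De //=.
  - by rewrite adj_irr in ab.
  - by move=> _ bB; exists b; rewrite // unfold_in bB.
  - by rewrite andbT => _ aB; exists a; rewrite 1?setUC // unfold_in aB adj_sym.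
  - by move=> /negP.
rewrite unfold_in => /andP[pB xp] ->; rewrite E2 !subUset !sub1set (negbTE xB) /=.
by rewrite !inE eqxx pB orbT.
Qed.

Lemma size_inU2 p q B : p \notin B -> q \notin B -> p != q ->
  size_in G (p |: (q |: B)) =
    (size_in G B + \sum_(r in B) G p r + \sum_(r in B) G q r + G p q)%N.
Proof.
move=> pB qB pq; rewrite !size_inU1 ?inE ?negb_or ?pq //.
rewrite big_setU1 //=; lia.
Qed.

Lemma size_in_gt0 A : (0 < size_in G A)%N ->
  exists x y, [/\ x \in A, y \in A & G x y].
Proof.
rewrite card_gt0 => /set0Pn[e]; rewrite inE => /andP[/edgesP[x [y [xy ->]]]].
by rewrite subUset !sub1set => /andP[xA yA]; exists x, y.
Qed.

(** The complement of [s] has at least [k] vertices, so its [k]-subsets have a positive binomial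
    count. Repetitions in [s] are harmless, as [size s] only overestimates its vertices. *)
Lemma exists_set_avoiding (s : seq T) k : (k + size s <= #|T|)%N ->
  exists R : {set T}, #|R| = k /\ {in s, forall v, v \notin R}.
Proof.
move=> le; have : (0 < #|[set R : {set T} | (R \subset ~: [set v in s]) & #|R| == k]|)%N.
  rewrite cards_draws bin_gt0 cardsCs setCK leq_subRL; last exact: max_card.
  apply: leq_trans le; rewrite addnC leq_add2l.
  by rewrite cardsE card_size.
rewrite card_gt0 => /set0Pn[R]; rewrite inE => /andP[sR /eqP cR].
exists R; split=> // v vs; apply: contraL (vs) => /(subsetP sR).
by rewrite !inE.
Qed.

Lemma exists_notin (s : seq T) : (size s < #|T|)%N -> exists v, v \notin s.
Proof.
move=> lt; have [|R [R1 Rs]] := @exists_set_avoiding s 1; first lia.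
have /cards1P[v Dv] : #|R| == 1%N by rewrite R1.
by exists v; apply/negP => /Rs; rewrite Dv inE eqxx.
Qed.

End GraphSizes.

(** Every 2-subset of [A] is an edge of exactly one of [G] and [compl G]. *)
Lemma size_in_compl (T : finType) (G : graph T) (A : {set T}) :
  (size_in G A + size_in (compl G) A)%N = 'C(#|A|, 2).
Proof.
rewrite -cards_draws -(cardsID (edges G)) /size_in.
move: (edges G) (edges (compl G)) (@card_edge _ G) (@edges_set2 _ G)
  (@card_edge _ (compl G)) (@edges_set2 _ (compl G)) => E F cE E2 cF F2.
congr addn; apply: eq_card => e; rewrite !inE.
  by case: (boolP (e \in E)) => eE; rewrite ?andbF // (cE _ eE) eqxx !andbT.
case: (boolP (e \subset A)) => sA; rewrite ?andbF //= andbT.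
case: cards2P => [[x [y [xy ->]]]|ne].
  by rewrite E2 F2 /= /compl_adj /= xy andbT.
by rewrite andbF; apply/negP => /cF /eqP/cards2P.
Qed.

(** * Graphs with two-valued subgraph sizes *)

Definition two_valued (T : finType) (G : graph T) (c l d : nat) : Prop :=
  forall A : {set T}, #|A| = c -> size_in G A = l \/ size_in G A = (l + d)%N.

Section Structure.
Variables (T : finType) (G : graph T).

Definition adj_diff (x y p : T) : int := (G x p : nat)%:Z - (G y p : nat)%:Z.

Lemma adj_diff_eq x y p : adj_diff x y p = 0 -> G x p = G y p.
Proof. by rewrite /adj_diff; do 2!case: (G _ _). Qed.

(** If all pairs are twins, any pair of distinct vertices can be moved to any other one endpoint at
    a time without changing adjacency, so adjacency is constant. *)
Lemma twins_trivial :
  (forall x y p, x != y -> p != x -> p != y -> adj_diff x y p = 0) ->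
  complete G \/ cocomplete G.
Proof.
move=> tw.
have H x y p : x != y -> p != x -> p != y -> G x p = G y p.
  by move=> xy px py; apply/adj_diff_eq/tw.
have const x y z w : x != y -> z != w -> G x y = G z w.
  move=> xy zw; case: (eqVneq z y) => [Dz|zy].
    subst z; case: (eqVneq x w) => [->|xw]; first by rewrite adj_sym.
    by rewrite (H x w y) // 1?[y == x]eq_sym // adj_sym.
  case: (eqVneq x z) => [Dx|xz].
    subst z; case: (eqVneq y w) => [->//|yw].
    by rewrite adj_sym [RHS]adj_sym; apply: H.
  have -> : G x y = G z y by apply: H; rewrite // eq_sym.
  case: (eqVneq y w) => [->//|yw].
  by rewrite adj_sym [RHS]adj_sym; apply: H; rewrite // eq_sym.
case: (boolP [exists x, exists y, G x y]).
  move=> /existsP[a /existsP[b ab]]; left=> x y xy.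
  by rewrite (const x y a b xy (adj_neq ab)).
move=> /existsPn ne; right=> x y xy /=; rewrite /compl_adj /= xy.
by have /existsPn := ne x; apply.
Qed.

(** If some difference is nonzero, then after swapping [x] and [y] it is 1 everywhere: [x] sees all
    other vertices and [y] none of them. The remaining freedom is whether [x] and [y] are adjacent,
    which decides between a star centred at [x] and the complement of a star centred at [y]. *)
Lemma constant_diff_structure : (4 <= #|T|)%N ->
  (forall x y p q, x != y -> p \notin [:: x; y] -> q \notin [:: x; y] ->
     adj_diff x y p = adj_diff x y q) ->
  [\/ complete G, cocomplete G, is_star G | is_star (compl G)].
Proof.
move=> n4 H.
case: (boolP [exists x, exists y, exists p, [&& x != y, p \notin [:: x; y], G x p & ~~ G y p]]);
  last first.
  move=> /existsPn ne; suff: complete G \/ cocomplete G.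
    by case; [constructor 1 | constructor 2].
  have gen x y p : x != y -> p \notin [:: x; y] -> G x p -> G y p.
    move=> xy pn xp; have /existsPn/(_ y)/existsPn/(_ p) := ne x.
    by rewrite xy pn xp /= negbK.
  apply: twins_trivial => x y p xy px py.
  suff E : G x p = G y p by rewrite /adj_diff E subrr.
  by apply/idP/idP; apply: gen; rewrite ?inE ?negb_or ?px ?py // eq_sym.
move=> /existsP[x /existsP[y /existsP[p /and4P[xy pn xp yp]]]].
have d1 q : q \notin [:: x; y] -> G x q /\ ~~ G y q.
  move=> qn; have := H x y q p xy qn pn; rewrite /adj_diff xp (negbTE yp).
  by do 2!case: (G _ _).
have d2 z z' q : z \notin [:: x; y] -> z' \notin [:: x; y] -> z != z' -> q \notin [:: z; z'] ->
    G z q = G z' q.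
  move=> zn z'n zz' qn; apply: adj_diff_eq; rewrite (H z z' q x) //.
    have [zx _] := d1 _ zn; have [z'x _] := d1 _ z'n.
    by rewrite /adj_diff 2!(adj_sym _ _ x) zx z'x.
  move: zn z'n; rewrite !inE !negb_or ![x == _]eq_sym => /andP[-> _] /andP[-> _] //.
have d3 z z' : z \notin [:: x; y] -> z' \notin [:: x; y] -> z != z' -> G z z' = ~~ G x y.
  move=> zn z'n zz'.
  have [zx zy] := d1 _ zn; have [z'x z'y] := d1 _ z'n.
  move: zn z'n; rewrite !inE !negb_or => /andP[nzx nzy] /andP[nz'x nz'y].
  have := H z y x z' nzy; rewrite !inE !negb_or eq_sym nzx xy [z' == z]eq_sym zz' nz'y.
  move=> /(_ isT isT); rewrite /adj_diff [G z x]adj_sym zx [G y x]adj_sym.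
  by rewrite (negbTE z'y); do 2!case: (G _ _).
case: (boolP (G x y)) => Gxy; rewrite Gxy /= in d3.
  constructor 3; exists x => u v.
  case: (eqVneq u v) => [->|uv] /=; first by rewrite adj_irr.
  case: (eqVneq u x) uv => [->|ux] xv.
    case: (eqVneq v y) => [->//|vy]; apply: (d1 _ _).1.
    by rewrite !inE negb_or eq_sym xv.
  case: (eqVneq v x) xv => [->|vx] uv /=.
    rewrite adj_sym; case: (eqVneq u y) => [->//|uy]; apply: (d1 _ _).1.
    by rewrite !inE negb_or ux.
  apply: negbTE; case: (eqVneq u y) uv => [->|uy] uv.
    by apply: (d1 _ _).2; rewrite !inE negb_or vx eq_sym.
  case: (eqVneq v y) uv => [->|vy] uv.
    by rewrite adj_sym; apply: (d1 _ _).2; rewrite !inE negb_or ux.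
  by rewrite d3 // !inE negb_or ?ux ?vx.
constructor 4; exists y => u v; rewrite /= /compl_adj /=.
case: (eqVneq u v) => [->|uv] //=.
case: (eqVneq u y) uv => [->|uy] uv /=.
  case: (eqVneq v x) uv => [->|vx] uv; first by rewrite adj_sym.
  by apply: (d1 _ _).2; rewrite !inE negb_or vx eq_sym.
case: (eqVneq v y) uv => [->|vy] uv /=.
  rewrite adj_sym; case: (eqVneq u x) uv => [->|ux] uv; first by rewrite adj_sym.
  by apply: (d1 _ _).2; rewrite !inE negb_or ux.
apply: negbTE; rewrite negbK.
case: (eqVneq u x) uv => [->|ux] uv.
  by apply: (d1 _ _).1; rewrite !inE negb_or vy eq_sym uv.
case: (eqVneq v x) uv => [->|vx] uv.
  by rewrite adj_sym; apply: (d1 _ _).1; rewrite !inE negb_or ux.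
by rewrite d3 // !inE negb_or ?ux ?vx.
Qed.

Definition subsingle (P : pred T) : Prop := forall v w, P v -> P w -> v = w.

(** Let [x] have two neighbours and two non-neighbours. Applying [F] to [x] and a non-neighbour,
    every non-neighbour misses at most one neighbour of [x] ([N1]); applying it to a neighbour and
    [x], every neighbour sees at most one non-neighbour ([N2]). Counting edges between the two sides
    shows that each vertex has degree or codegree at most 1, and the two kinds cannot be mixed. *)
Lemma low_or_high_degree : (8 <= #|T|)%N ->
  (forall x y v w, uniq [:: x; y; v; w] -> G x v -> G x w -> ~~ G y v -> G y w) ->
  (forall x, subsingle (G x)) \/ (forall x, subsingle (compl G x)).
Proof.
move=> n8 F.
have dich x : subsingle (G x) \/ subsingle (compl G x).
  case: (boolP [exists v, exists w, [&& v != w, G x v & G x w]]); last first.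
    move=> ne; left=> v w xv xw; apply/eqP; apply: contraNT ne => vw.
    by apply/existsP; exists v; apply/existsP; exists w; rewrite vw xv.
  case/existsP=> v /existsP[w /and3P[vw xv xw]]; right=> p q.
  rewrite /= /compl_adj /= => /andP[xp nxp] /andP[xq nxq]; apply/eqP/negPn/negP => pq.
  have N1 a b e : a != b -> G x a -> G x b -> x != e -> ~~ G x e -> G a e || G b e.
    move=> ab xa xb xe nxe; rewrite -implyNb; apply/implyP => ae.
    rewrite adj_sym; apply: (F x e a b) => //; last by rewrite adj_sym.
    rewrite /= !inE !negb_or xe ab (adj_neq xa) (adj_neq xb) !(eq_sym e) /= !andbT.
    by apply/andP; split; apply: contraNneq nxe => <-.
  have N2 a e f : e != f -> G x a -> x != e -> ~~ G x e -> x != f -> ~~ G x f ->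
      ~~ (G a e && G a f).
    move=> ef xa xe nxe xf nxf; apply/andP=> -[ae af].
    apply: (negP nxf); apply: (F a x e f) => //.
    by rewrite /= !inE !negb_or xe xf ef (adj_neq ae) (adj_neq af) eq_sym (adj_neq xa).
  (* A fifth vertex [z] breaks the count. With three neighbours, [p] and [q] need two edges each,
     but [v], [w], [z] allow three in all. With three non-neighbours, each needs an edge, but [v]
     and [w] allow only two in all. *)
  have [|z] := @exists_notin _ [:: x; v; w; p; q]; first exact: leq_trans n8.
  rewrite !inE !negb_or ![z == _]eq_sym => /and5P[xz vz wz pz qz].
  move: (N1 v w p vw xv xw xp nxp) (N1 v w q vw xv xw xq nxq).
  move: (N2 v p q pq xv xp nxp xq nxq) (N2 w p q pq xw xp nxp xq nxq).
  case: (boolP (G x z)) => [Gxz|nxz].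
    move: (N1 v z p vz xv Gxz xp nxp) (N1 v z q vz xv Gxz xq nxq).
    move: (N1 w z p wz xw Gxz xp nxp) (N1 w z q wz xw Gxz xq nxq).
    move: (N2 z p q pq Gxz xp nxp xq nxq).
    by case: (G v p); case: (G v q); case: (G w p); case: (G w q);
       case: (G z p); case: (G z q).
  move: (N1 v w z vw xv xw xz nxz).
  move: (N2 v p z pz xv xp nxp xz nxz) (N2 v q z qz xv xq nxq xz nxz).
  move: (N2 w p z pz xw xp nxp xz nxz) (N2 w q z qz xw xq nxq xz nxz).
  by case: (G v p); case: (G v q); case: (G w p); case: (G w q);
     case: (G v z); case: (G w z).
have lowP x : reflect (subsingle (G x)) [forall v, forall w, G x v ==> G x w ==> (v == w)].
  apply: (iffP forallP) => [L v w xv xw|L v].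
    by have /forallP/(_ w) := L v; rewrite xv xw => /eqP.
  by apply/forallP => w; apply/implyP => xv; apply/implyP => xw; apply/eqP/L.
have highP x : reflect (subsingle (compl G x))
    [forall v, forall w, compl G x v ==> compl G x w ==> (v == w)].
  apply: (iffP forallP) => [L v w xv xw|L v].
    by have /forallP/(_ w) := L v; rewrite xv xw => /eqP.
  by apply/forallP => w; apply/implyP => xv; apply/implyP => xw; apply/eqP/L.
case: (boolP [forall x, [forall v, forall w, G x v ==> G x w ==> (v == w)]]).
  by move=> /forallP H; left=> x; apply/lowP.
case/forallPn=> x /lowP nlx.
have hx : subsingle (compl G x) by case: (dich x).
right=> y; case: (dich y) => // ly.
case: (eqVneq x y) => [Dx|xy]; first by subst y; case: nlx.
exfalso.
(* Among four further vertices at most one is a non-neighbour of [x] and at most one is a neighbour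
   of [y]; the other two contradict [F]. *)
have [|R [R4 Rxy]] := @exists_set_avoiding _ [:: x; y] 4; first exact: leq_trans n8.
have [v [w [vR wR vw [xv xw [yv yw]]]]] : exists v w, [/\ v \in R, w \in R, v != w &
    [/\ G x v, G x w & ~~ G y v /\ ~~ G y w]].
  pose bad := [set v in R | compl G x v] :|: [set v in R | G y v].
  have le2 : (#|bad| <= 2)%N.
    apply: leq_trans (leq_card_setU _ _) _; apply: (@leq_add _ _ 1 1); apply/card_le1_eqP => v w.
      by rewrite !inE => /andP[_ h1] /andP[_ h2]; apply: hx.
    by rewrite !inE => /andP[_ h1] /andP[_ h2]; apply: ly.
  have : (1 < #|R :\: bad|)%N.
    by have := cardsID bad R; have := subset_leq_card (subsetIr R bad); lia.
  case/card_gt1P=> v [w [vD wD vw]]; exists v, w.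
  have good u : u \in R :\: bad -> [/\ u \in R, G x u & ~~ G y u].
    rewrite !inE => /andP[+ uR]; rewrite uR /= /compl_adj /= negb_or negb_and negbK.
    have : x != u by rewrite eq_sym; apply: contraL uR => /eqP ->; apply: Rxy; rewrite inE eqxx.
    by move=> xu; rewrite (negbTE xu) /= => /andP[/negPn -> ->].
  by have [? ? ?] := good v vD; have [? ? ?] := good w wD.
apply: (negP yw); apply: (F x y v w) => //.
rewrite /= !inE !negb_or xy vw /= !andbT.
have nR u z : u \in [:: x; y] -> z \in R -> u != z.
  by move=> un zR; apply: contraL zR => /eqP <-; apply: Rxy.
by rewrite !nR ?inE ?eqxx ?orbT.
Qed.

End Structure.

(** The witness of size [l + d] guarantees [l + d <= 'C(c, 2)], so that the truncated subtraction is
    exact. *)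
Lemma two_valued_compl (T : finType) (G : graph T) (c l d : nat) : (0 < d)%N ->
  (exists A : {set T}, #|A| = c /\ size_in G A = (l + d)%N) ->
  two_valued G c l d -> two_valued (compl G) c ('C(c, 2) - (l + d)) d.
Proof.
move=> d0 [A0 [cA0 eA0]] tv A cA.
have := size_in_compl G A; have := size_in_compl G A0; rewrite cA cA0 eA0.
by case: (tv A cA) => ->; lia.
Qed.

Definition in_gap (d : nat) (s : int) : Prop := [\/ s = 0, s = d%:Z | s = - d%:Z].

Lemma in_gap_bounds d s : in_gap d s -> - d%:Z <= s <= d%:Z.
Proof. by case=> ->; lia. Qed.

(** The sums differ by at most 2, whereas distinct values among 0, [d] and [-d] are at least 3
    apart; for [d = 0] there is only one value. *)
Lemma in_gap_large d a b s : d != 1%N -> d != 2%N ->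
  -1 <= a <= 1 -> -1 <= b <= 1 -> in_gap d (a + s) -> in_gap d (b + s) -> a = b.
Proof.
case: d => [|[//|[//|d]]] _ _; case/andP=> ? ?; case/andP=> ? ?; case=> ?; case=> ?; lia.
Qed.

(** All admissible sums are even, so [a] is even. *)
Lemma in_gap2_parity a s : -1 <= a <= 1 -> in_gap 2 (a + s) -> in_gap 2 (0 + s) -> a = 0.
Proof. by move=> /andP[? ?]; case=> ?; case=> ?; lia. Qed.

Lemma in_gap2_far s : in_gap 2 (3 + s) -> ~ in_gap 2 (-3 + s).
Proof. by move=> /in_gap_bounds ? /in_gap_bounds; lia. Qed.

(** * Exchange arguments for two-valued sizes *)

Section TwoValued.
Variables (T : finType) (G : graph T) (c l d : nat).
Hypotheses (c4 : (4 <= c)%N) (cn : (c + 4 <= #|T|)%N).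
Hypothesis tv : two_valued G c l d.
Implicit Types (x y p q v w : T) (R : {set T}).

(** With [j] vertices of a set of order [c] prescribed, the other [c - j] leave at least [j + 4]
    vertices outside. Both bounds on [c] enter here. *)
Lemma exists_avoiding j (s : seq T) : (j <= 4)%N -> (size s <= j + 4)%N ->
  exists R : {set T}, #|R| = (c - j)%N /\ {in s, forall v, v \notin R}.
Proof.
move=> j4 sj; apply: exists_set_avoiding; apply: leq_trans cn.
by rewrite -(leq_add2l (c - j)) addnA subnK in sj; last exact: leq_trans c4.
Qed.

Lemma notin_short (s : seq T) : (size s < 8)%N -> exists v, v \notin s.
Proof.
move=> s8; apply: exists_notin; apply: leq_trans s8 _; apply: leq_trans cn.
by rewrite (leq_add2r 4 4).
Qed.

Lemma subn_predK j : (0 < j <= 4)%N -> (j.-1 + (c - j)).+1 = c.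
Proof. by case: j => // j jc; rewrite -addSn subnKC //; apply: leq_trans c4. Qed.

Definition diff_sum x y R : int := \sum_(p in R) adj_diff G x y p.

(* Exchanging [x] for [y] in a set of [c] vertices changes its size by a sum of
   values of [adj_diff], and by [0], [d] or [-d] as sizes are two-valued. *)
Lemma diff_sum_extend x y (P : seq T) R : uniq (x :: y :: P) ->
  {in x :: y :: P, forall v, v \notin R} -> (size P + #|R|).+1 = c ->
  let s := \sum_(p <- P) adj_diff G x y p + diff_sum x y R in
  in_gap d s.
Proof.
move=> uP nR cP.
pose B := [set v in P] :|: R.
have dis : [disjoint [set v in P] & R].
  apply/pred0P => v; rewrite /= inE; apply/negbTE/negP => /andP[vP].
  by apply/negP/nR; rewrite !inE vP !orbT.
have cB : #|B| = (size P + #|R|)%N.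
  rewrite cardsU; move: dis; rewrite -setI_eq0 => /eqP ->; rewrite cards0 subn0.
  by rewrite cardsE (card_uniqP _) //; case/and3P: uP.
have xB : x \notin B.
  rewrite !inE negb_or nR ?inE ?eqxx // andbT.
  by case/andP: uP; rewrite inE negb_or => /andP[].
have yB : y \notin B.
  by rewrite !inE negb_or nR ?inE ?eqxx ?orbT // andbT; case/and3P: uP.
have := tv (A := x |: B); have := tv (A := y |: B).
rewrite !cardsU1 xB yB cB !add1n cP !size_inU1 //.
have -> : \sum_(p <- P) adj_diff G x y p + diff_sum x y R = \sum_(p in B) adj_diff G x y p.
  rewrite [RHS](eq_bigl [predU [set v in P] & R]) => [|p]; last by rewrite in_setU.
  have uPP : uniq P by case/and3P: uP.
  rewrite [RHS]bigU //= (big_uniq _ uPP) /=; congr (_ + _).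
  by apply: eq_bigl => p; rewrite inE.
rewrite sumrB -!(big_morph Posz PoszD erefl); set a := (\sum_(_ in _) _)%N; set b := (\sum_(_ in _) _)%N.
move=> /(_ erefl) hy /(_ erefl) hx.
case: hx hy => hx [] hy.
- by constructor 1; lia.
- by constructor 3; lia.
- by constructor 2; lia.
- by constructor 1; lia.
Qed.

(** Both sets are completed by the same [R] of [c - 2] vertices, so the two sums share the summand
    [s]. *)
Lemma diff_pair x y p q : uniq [:: x; y; p; q] ->
  exists s : int,
    in_gap d (adj_diff G x y p + s) /\ in_gap d (adj_diff G x y q + s).
Proof.
move=> u; have [//|//|R [cR nR]] := @exists_avoiding 2 [:: x; y; p; q].
exists (diff_sum x y R); split.
  have := @diff_sum_extend x y [:: p] R; rewrite big_seq1; apply.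
  - by move: u; rewrite /= !inE !negb_or !andbT => /and3P[/and3P[-> -> _] /andP[-> _] _].
  - by move=> v vs; apply: nR; move: vs; rewrite !inE => /or3P[] ->; rewrite ?orbT.
  - by rewrite /= cR; exact: (@subn_predK 2).
have := @diff_sum_extend x y [:: q] R; rewrite big_seq1; apply.
- by move: u; rewrite /= !inE !negb_or !andbT => /and3P[/and3P[-> _ ->] /andP[_ ->] _].
- by move=> v vs; apply: nR; move: vs; rewrite !inE => /or3P[] ->; rewrite ?orbT.
- by rewrite /= cR; exact: (@subn_predK 2).
Qed.

Lemma adj_diff_bounds x y p : -1 <= adj_diff G x y p <= 1.
Proof. by rewrite /adj_diff; do 2!case: (G _ _). Qed.

Lemma adj_diff_cases x y p :
  [\/ adj_diff G x y p = 0, adj_diff G x y p = 1 | adj_diff G x y p = -1].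
Proof.
by rewrite /adj_diff; do 2!case: (G _ _);
  [constructor 1|constructor 2|constructor 3|constructor 1].
Qed.

Lemma constant_diff_of_gap x y p q : d != 1%N -> d != 2%N ->
  x != y -> p \notin [:: x; y] -> q \notin [:: x; y] ->
  adj_diff G x y p = adj_diff G x y q.
Proof.
move=> d1 d2 xy; rewrite !inE !negb_or => /andP[px py] /andP[qx qy].
case: (eqVneq p q) => [->//|pq].
have [|s [hp hq]] := @diff_pair x y p q.
  by rewrite /= !inE !negb_or xy ![_ == p]eq_sym ![_ == q]eq_sym px py qx qy [q == p]eq_sym pq.
exact: in_gap_large d1 d2 (adj_diff_bounds x y p) (adj_diff_bounds x y q) hp hq.
Qed.

(** The differences have a common value by [constant_diff_of_gap], and [c - 1] copies of it sum to
    zero. *)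
Lemma gap0_trivial : d = 0%N -> complete G \/ cocomplete G.
Proof.
move=> d0; apply: twins_trivial => x y p xy px py.
have [//|//|R [cR nR]] := @exists_avoiding 1 [:: x; y].
have h := @diff_sum_extend x y [::] R; rewrite big_nil add0r in h.
have {}h : diff_sum x y R = 0.
  move: h; rewrite d0 /= inE xy cR => h.
  by case: h => //; exact: (@subn_predK 1).
move: h; rewrite /diff_sum (eq_bigr (fun=> adj_diff G x y p)); last first.
  move=> q qR; apply: constant_diff_of_gap; rewrite ?d0 //; last first.
    by rewrite !inE negb_or px py.
  by apply: contraL qR; apply: nR.
rewrite sumr_const cR => /eqP; rewrite mulrn_eq0 => /orP[|/eqP//].
by rewrite subn_eq0 leqNgt; case/negP; apply: leq_trans c4.
Qed.

(* By parity one nonzero difference makes all of them 1 or -1; swapping three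
   vertices of each sign then changes the sum by 6 > 2 d. *)
Lemma gap2_trivial : d = 2 -> complete G \/ cocomplete G.
Proof.
move=> d2; apply: twins_trivial => x y p xy px py; apply/eqP/negPn/negP => gp.
have pm q : q \notin [:: x; y] -> adj_diff G x y q = 1 \/ adj_diff G x y q = -1.
  rewrite !inE negb_or => /andP[qx qy].
  case: (eqVneq p q) => [<-|pq]; first by case: (adj_diff_cases x y p) gp => -> // _; [left|right].
  have [|s [hp hq]] := @diff_pair x y p q.
    by rewrite /= !inE !negb_or xy ![_ == p]eq_sym ![_ == q]eq_sym px py qx qy [q == p]eq_sym pq.
  case: (adj_diff_cases x y q); [|tauto|tauto] => gq.
  rewrite gq d2 in hp hq; case/eqP: gp.
  exact: in_gap2_parity (adj_diff_bounds x y p) hp hq.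
pose X := [set q | q \notin [:: x; y] & adj_diff G x y q == 1].
pose Y := [set q | q \notin [:: x; y] & adj_diff G x y q == -1].
have cXY : (#|X| + #|Y| + 2 = #|T|)%N.
  have c2 : #|[set x; y]| = 2 by rewrite cards2 xy.
  rewrite -(cardsC [set x; y]) c2 addnC; congr addn.
  rewrite -(cardsID X (~: _)); congr addn; apply: eq_card => q; rewrite !inE negb_or.
    by case: (q == x); case: (q == y).
  case: eqVneq => [//|qx]; case: eqVneq => [//|qy]; rewrite ?andbF //=.
  by have [|->|->] := pm q; rewrite // !inE negb_or qx qy.
(* A set with [c - 1] differences of one sign would give a sum of absolute value [c - 1 >= 3], above
   the gap 2. *)
have small (Z : {set T}) (s : int) : s = 1 \/ s = -1 ->
    {in Z, forall q, q \notin [:: x; y] /\ adj_diff G x y q = s} -> (#|Z| <= c - 2)%N.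
  move=> hs hZ; rewrite leqNgt; apply/negP => lt.
  have : (0 < #|[set R : {set T} | (R \subset Z) & #|R| == (c - 1)%N]|)%N.
    by rewrite cards_draws bin_gt0; clear -lt; lia.
  rewrite card_gt0 => /set0Pn[R]; rewrite inE => /andP[/subsetP sR /eqP cR].
  have h := @diff_sum_extend x y [::] R; rewrite big_nil add0r in h.
  move: h; rewrite /diff_sum (eq_bigr (fun=> s)); last by move=> q /sR /hZ[].
  rewrite sumr_const cR /= !inE xy => h.
  have {}h : in_gap d (s *+ (c - 1)).
    by apply: h => //; [move=> v vs; apply: contraL vs => /sR /hZ[] | exact: (@subn_predK 1)].
  move/in_gap_bounds: h; rewrite -mulr_natr natz d2.
  have : (3 <= c - 1)%N by rewrite leq_subRL // ltnW // ltnW // ltnW.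
  by clear -hs; case: hs => ->; lia.
have hX : {in X, forall q, q \notin [:: x; y] /\ adj_diff G x y q = 1}.
  by move=> q; rewrite inE => /andP[-> /eqP].
have hY : {in Y, forall q, q \notin [:: x; y] /\ adj_diff G x y q = -1}.
  by move=> q; rewrite inE => /andP[-> /eqP].
(* If [X] had at most two vertices, [Y] would have at least n - 4 >= c, more than [small] allows;
   the same holds with [X] and [Y] exchanged. *)
case: (ltnP 2 #|X|) => X3; last first.
  by have := @small Y (-1) (or_intror erefl) hY; move: c4 cn cXY X3; clear; lia.
case: (ltnP 2 #|Y|) => Y3; last first.
  by have := @small X 1 (or_introl erefl) hX; move: c4 cn cXY Y3; clear; lia.
have [p1 [p2 [p3 [[X1 X2 X3'] [n12 n23 n31]]]]] := card_gt2P X3.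
have [q1 [q2 [q3 [[Y1 Y2 Y3'] [m12 m23 m31]]]]] := card_gt2P Y3.
have [//|//|R [cR nR]] := @exists_avoiding 4 [:: x; y; p1; p2; p3; q1; q2; q3].
have ext a b e (s : int) : {in [:: a; b; e], forall q, [/\ q \in [:: p1; p2; p3; q1; q2; q3],
     q \notin [:: x; y] & adj_diff G x y q = s]} -> a != b -> b != e -> e != a ->
    in_gap d (s * 3 + diff_sum x y R).
  move=> h ab be ea; have := @diff_sum_extend x y [:: a; b; e] R.
  have [ia na ga] := h a (mem_head _ _).
  have [|ib nb gb] := h b; first by rewrite !inE eqxx orbT.
  have [|ie ne ge] := h e; first by rewrite !inE eqxx !orbT.
  rewrite !big_cons big_nil ga gb ge addr0.
  have -> : s + (s + s) = s * 3 by ring.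
  move: na nb ne; rewrite !inE !negb_or => /andP[ax ay] /andP[bx by_] /andP[ex ey].
  apply.
  - rewrite /= !inE !negb_or xy ![x == _]eq_sym ![y == _]eq_sym ax bx ex ay by_ ey ab be.
    by rewrite eq_sym ea.
  - move=> v; rewrite in_cons => /predU1P[->|].
      by apply: nR; rewrite inE eqxx.
    rewrite in_cons => /predU1P[->|]; first by apply: nR; rewrite !inE eqxx orbT.
    rewrite !in_cons in_nil orbF => /or3P vs; apply: nR; rewrite 2!in_cons.
    by case: vs => /eqP ->; rewrite ?ia ?ib ?ie !orbT.
  - by rewrite /= cR; exact: (@subn_predK 4).
have hp : in_gap d (1 * 3 + diff_sum x y R).
  apply: (ext p1 p2 p3) => // q; rewrite !in_cons in_nil orbF => /or3P[] /eqP ->.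
  - by have [? ?] := hX _ X1; rewrite eqxx.
  - by have [? ?] := hX _ X2; rewrite eqxx ?orbT.
  - by have [? ?] := hX _ X3'; rewrite eqxx ?orbT.
have hq : in_gap d (-1 * 3 + diff_sum x y R).
  apply: (ext q1 q2 q3) => // q; rewrite !in_cons in_nil orbF => /or3P[] /eqP ->.
  - by have [? ?] := hY _ Y1; rewrite eqxx ?orbT.
  - by have [? ?] := hY _ Y2; rewrite eqxx ?orbT.
  - by have [? ?] := hY _ Y3'; rewrite eqxx ?orbT.
by rewrite d2 mul1r mulN1r in hp hq; apply: in_gap2_far hp hq.
Qed.

(** Otherwise [v] and [w] contribute 2 to the sum, and the rest must compensate in every completion.
    Either the rest can be chosen nonnegative, or two vertices of difference -1 can replace [v] and
    [w], shifting the sum by 4 although admissible sums span only 2. *)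
Lemma gap1_forbidden x y v w : d = 1%N -> uniq [:: x; y; v; w] ->
  G x v -> G x w -> ~~ G y v -> G y w.
Proof.
move=> d1 u xv xw /negbTE yv; apply/negPn/negP => /negbTE yw.
have gv : adj_diff G x y v = 1 by rewrite /adj_diff xv yv.
have gw : adj_diff G x y w = 1 by rewrite /adj_diff xw yw.
pose Y := [set q | q \notin [:: x; y] & adj_diff G x y q == -1].
(* At most one vertex has difference -1, so [R] can avoid it. *)
case: (leqP #|Y| 1) => [Y1|/card_gt1P[y1 [y2 [Y1 Y2 y12]]]].
  have [//||R [cR nR]] := @exists_avoiding 3 ([:: x; y; v; w] ++ enum Y).
    by rewrite size_cat -cardE (leq_add2l 4 _ 3) (leq_trans Y1).
  have := @diff_sum_extend x y [:: v; w] R u; rewrite !big_cons big_nil gv gw.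
  have : 0 <= diff_sum x y R.
    apply: sumr_ge0 => q qR; case: (adj_diff_cases x y q) => gq; rewrite gq //.
    have : q \in Y; last first.
      move=> qY; have /negP[] : q \notin R by apply: nR; rewrite mem_cat mem_enum qY orbT.
      exact: qR.
    rewrite inE gq eqxx andbT; apply: contraL qR => qxy; apply: nR.
    by rewrite mem_cat; move: qxy; rewrite !inE => /orP[] ->; rewrite ?orbT.
  move=> s0; rewrite d1 /= cR addr0 => h.
  have /in_gap_bounds/andP[_] : in_gap 1 (1 + 1 + diff_sum x y R).
    by apply: h; [move=> q qs; apply: nR; rewrite mem_cat qs | exact: (@subn_predK 3)].
  by apply/negP; rewrite -ltNge ltr_wpDr.
move: Y1 Y2; rewrite !inE !negb_or -!andbA => /and3P[y1x y1y /eqP g1] /and3P[y2x y2y /eqP g2].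
have nYv q : adj_diff G x y q = -1 -> (q != v) && (q != w).
  by move=> gq; apply/andP; split; apply: contra_eq_neq gq => ->; rewrite ?gv ?gw.
have /andP[y1v y1w] := nYv _ g1; have /andP[y2v y2w] := nYv _ g2.
have [//|p pn] := @notin_short [:: x; y; v; w; y1; y2].
have [//|q qn'] := @notin_short [:: p; x; y; v; w; y1; y2].
have qn : q \notin [:: x; y; v; w; y1; y2] by move: qn'; rewrite in_cons negb_or => /andP[].
have [//|//|R [cR nR]] := @exists_avoiding 4 [:: x; y; v; w; y1; y2; p; q].
have nRs (s : seq T) : {subset s <= [:: x; y; v; w; y1; y2; p; q]} ->
    {in s, forall z, z \notin R} by move=> h z /h /nR.
(* With [z] and [R] completing the set, [v] and [w] force the contribution of [z] and [R] to be at
   most -1; in [A2], [y1] and [y2] force it to be at least 1. *)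
have A1 z : z \in [:: p; q] -> z \notin [:: x; y; v; w; y1; y2] ->
    2 + adj_diff G x y z + diff_sum x y R <= 1.
  move=> zpq; rewrite !inE !negb_or => /and5P[zx zy zv zw _].
  have U : uniq [:: x; y; v; w; z].
    rewrite /= !inE !negb_or ![_ == z]eq_sym zx zy zv zw !andbT.
    by move: u; rewrite /= !inE !negb_or !andbT.
  suff /in_gap_bounds/andP[_ ] : in_gap 1 (1 + 1 + adj_diff G x y z + diff_sum x y R) by [].
  have := diff_sum_extend U (R := R); rewrite !big_cons big_nil gv gw addr0 !addrA d1 /= cR.
  apply; last exact: (@subn_predK 4).
  apply: nRs => t; rewrite !in_cons in_nil !orbF.
  by case/or4P=> [->|->|->|/orP[->|/eqP ->]]; rewrite ?orbT //;
     move: zpq; rewrite !inE => ->; rewrite !orbT.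
have A2 z : z \in [:: p; q] -> z \notin [:: x; y; v; w; y1; y2] ->
    -1 <= -2 + adj_diff G x y z + diff_sum x y R.
  move=> zpq; rewrite !inE !negb_or => /and5P[zx zy _ _ /andP[z1 z2]].
  have U : uniq [:: x; y; y1; y2; z].
    rewrite /= !inE !negb_or ![_ == z]eq_sym zx zy z1 z2 y12.
    rewrite ![x == _]eq_sym ![y == _]eq_sym y1x y2x y1y y2y.
    by move: u; rewrite /= !inE !negb_or => /and3P[/and3P[->]].
  suff /in_gap_bounds/andP[+ _] : in_gap 1 (-1 - 1 + adj_diff G x y z + diff_sum x y R) by [].
  have := diff_sum_extend U (R := R); rewrite !big_cons big_nil g1 g2 addr0 !addrA d1 /= cR.
  apply; last exact: (@subn_predK 4).
  apply: nRs => t; rewrite !in_cons in_nil !orbF.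
  by case/or4P=> [->|->|->|/orP[->|/eqP ->]]; rewrite ?orbT //;
     move: zpq; rewrite !inE => ->; rewrite !orbT.
have := A1 p (mem_head _ _) pn; have := A2 p (mem_head _ _) pn.
have qpq : q \in [:: p; q] by rewrite !inE eqxx orbT.
have := A1 q qpq qn; have := A2 q qpq qn; clear; lia.
Qed.

(** Two disjoint edges [a b] and [x y] pin the size of every set of order [c - 2] avoiding them to
    one positive value. Such a set then contains an edge, and exchanging vertices across that edge
    changes the size. *)
Lemma gap1_matching : d = 1%N -> (forall x, subsingle (G x)) ->
  cocomplete G \/ is_single_edge G.
Proof.
move=> d1 low.
case: (boolP [exists a, exists b, G a b]); last first.
  move=> /existsPn ne; left=> x y xy; rewrite /= /compl_adj /= xy.
  by have /existsPn := ne x; apply.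
move=> /existsP[a /existsP[b ab]]; right.
have nbr x y z : G x y -> z != y -> G x z = false.
  by move=> xy zy; apply/negP => /(low _ _ _ xy) E; rewrite E eqxx in zy.
exists a, b; split; first exact: (adj_neq ab).
move=> x y; apply/idP/idP; last first.
  by case/orP=> /andP[/eqP-> /eqP->] //; rewrite adj_sym.
move=> xy; apply/negPn/negP => ne.
have ba : G b a by rewrite adj_sym.
have yx : G y x by rewrite adj_sym.
have xa : x != a.
  by apply: contraNneq ne => E; subst x; rewrite (low _ _ _ ab xy) !eqxx.
have xb : x != b.
  by apply: contraNneq ne => E; subst x; rewrite (low _ _ _ ba xy) !eqxx orbT.
have ya : y != a.
  by apply: contraNneq ne => E; subst y; rewrite (low _ _ _ ab yx) !eqxx orbT.
have yb : y != b.
  by apply: contraNneq ne => E; subst y; rewrite (low _ _ _ ba yx) !eqxx.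
have nab := adj_neq ab; have nxy := adj_neq xy.
have sum0 u v (R : {set T}) : G u v -> v \notin R -> (\sum_(r in R) G u r = 0)%N.
  by move=> uv vR; rewrite big1 // => r rR; rewrite (nbr _ _ _ uv) //; apply: contraNneq vR => <-.
have inv2 p q (R : {set T}) : p != q -> p \notin R -> q \notin R -> #|p |: (q |: R)| = #|R|.+2.
  by move=> pq pR qR; rewrite !cardsU1 !inE negb_or pq pR qR.
(* Adding [a] and [b] to [C] creates one edge. Adding [a] and [x] creates none, since their partners
   stay outside. Sizes [l] and [l + 1] only leave [l] for [C]. *)
have key (C : {set T}) : #|C| = (c - 2)%N -> {in [:: a; b; x; y], forall v, v \notin C} ->
    size_in G C = l.
  move=> cC nC.
  have [aC bC xC yC] : [/\ a \notin C, b \notin C, x \notin C & y \notin C].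
    by split; apply: nC; rewrite !inE eqxx ?orbT.
  have := tv (A := a |: (b |: C)); have := tv (A := a |: (x |: C)).
  have ax : a != x by rewrite eq_sym.
  rewrite !inv2 // !size_inU2 // (sum0 a b) // (sum0 b a) // (sum0 x y) // cC.
  rewrite ab (nbr a b x) // d1 (@subn_predK 2) // => /(_ erefl) + /(_ erefl).
  by move: (size_in G C) => m; clear; lia.
have [//|//|R [cR nR]] := @exists_avoiding 4 [:: a; b; x; y].
have [aR bR xR yR] : [/\ a \notin R, b \notin R, x \notin R & y \notin R].
  by split; apply: nR; rewrite !inE eqxx ?orbT.
(* A set of order [c] containing both edges has size at least 2, and sizes are at most [l + 1]. *)
have l0 : (0 < l)%N.
  have [aE bE] : a \notin x |: (y |: R) /\ b \notin x |: (y |: R).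
    by rewrite !inE ![a == _]eq_sym ![b == _]eq_sym !negb_or xa xb ya yb aR bR.
  have := tv (A := a |: (b |: (x |: (y |: R)))); rewrite !inv2 //.
  rewrite !size_inU2 // (sum0 a b) // (sum0 b a) // ab xy d1 cR (@subn_predK 4) // => /(_ erefl).
  by clear; lia.
have [//|//|C [cC nC]] := @exists_avoiding 2 [:: a; b; x; y].
have [|p [q [pC qC pq]]] := @size_in_gt0 _ G C; first by rewrite key.
have pn : p \notin [:: a; b; x; y] by apply/negP => /nC; rewrite pC.
have qn : q \notin [:: a; b; x; y] by apply/negP => /nC; rewrite qC.
(* The second difference of sizes along [p, s] and [q, r] is [1 + G s r], but
   all four sizes equal [l]. *)
have qp : G q p by rewrite adj_sym.
have [//|r rn] := @notin_short [:: p; q; a; b; x; y].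
have [//|s sn] := @notin_short [:: r; p; q; a; b; x; y].
have [//|//|R' [cR' nR']] := @exists_avoiding 4 [:: s; r; p; q; a; b; x; y].
have [sR' rR' pR' qR'] : [/\ s \notin R', r \notin R', p \notin R' & q \notin R'].
  by split; apply: nR'; rewrite !inE eqxx ?orbT.
move: rn sn; rewrite in_cons negb_or => /andP[rp]; rewrite in_cons negb_or => /andP[rq rn].
rewrite in_cons negb_or => /andP[sr]; rewrite in_cons negb_or => /andP[sp].
rewrite in_cons negb_or => /andP[sq sn].
have keyU u v : u != v -> u \notin R' -> v \notin R' -> u \notin [:: a; b; x; y] ->
    v \notin [:: a; b; x; y] -> size_in G (u |: (v |: R')) = l.
  move=> uv uR vR un vn; apply: key; first by rewrite inv2 // cR' -[in RHS](@subn_predK 4) // subn2.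
  move=> t tn; rewrite !inE !negb_or nR' ?andbT; last by move: tn; rewrite !in_cons => ->; rewrite !orbT.
  by apply/andP; split; apply: contraTneq tn => ->.
have pq' := adj_neq pq.
have [pr ps] : p != r /\ p != s by rewrite ![p == _]eq_sym.
have := keyU p q pq' pR' qR' pn qn; have := keyU s r sr sR' rR' sn rn.
have := keyU p r pr pR' rR' pn rn; have := keyU s q sq sR' qR' sn qn.
rewrite !size_inU2 // pq (nbr p q r pq rq) [G s q]adj_sym (nbr q p s qp sp) /=; clear; lia.
Qed.

End TwoValued.

Lemma two_valued_constant (T : finType) (G : graph T) (c l : nat) :
  (4 <= c)%N -> (c + 4 <= #|T|)%N -> two_valued G c l 0 -> complete G \/ cocomplete G.
Proof. by move=> c4 cn tv; apply: (gap0_trivial c4 cn tv). Qed.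

Lemma cocomplete_complK (T : finType) (G : graph T) : cocomplete (compl G) -> complete G.
Proof. by move=> h x y xy; have := h x y xy; rewrite /= /compl_adj /= /compl_adj /= xy /= negbK. Qed.

Lemma two_valued_extremal (T : finType) (G : graph T) (c l d : nat) :
  ~ complete G -> ~ cocomplete G -> (4 <= c)%N -> (c + 4 <= #|T|)%N ->
  (exists A : {set T}, #|A| = c /\ size_in G A = (l + d)%N) ->
  two_valued G c l d -> extremal G.
Proof.
move=> nc ncc c4 cn wit tv.
case: (eqVneq d 2) => [d2|d2]; first by case: (gap2_trivial c4 cn tv d2).
case: (eqVneq d 1%N) => [d1|d1].
  have [||low|high] := @low_or_high_degree _ G.
  - by move: cn; lia.
  - by move=> x y v w; apply: (gap1_forbidden c4 cn tv d1).
  - by case: (gap1_matching c4 cn tv d1 low) => // ?; constructor 2.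
  (* Here [high] says that the complement is a matching, so the matching argument is applied to
     [compl G]. *)
  have tvc := two_valued_compl _ wit tv.
  have := gap1_matching c4 cn (tvc _) d1 high; case; rewrite ?d1 // => h.
    by case: nc; apply: cocomplete_complK.
  by constructor 4.
have n4 : (4 <= #|T|)%N by apply: leq_trans cn; apply: leq_addl.
have H := constant_diff_of_gap c4 cn tv d1 d2.
by case: (constant_diff_structure n4 H) => // ?; [constructor 1|constructor 3].
Qed.

(** * The bounds *)

Section Bounds.
Variables (T : finType) (G : graph T).
Implicit Types A B : {set T}.

Lemma size_in_le A : (size_in G A <= 'C(#|A|, 2))%N.
Proof. by rewrite -(size_in_compl G A) leq_addr. Qed.

Lemma size_in_product A B : (forall x y, G x y -> (x \in B) != (y \in B)) ->
  (size_in G A <= #|A :&: B| * #|A :\: B|)%N.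
Proof.
move=> bip; rewrite -cardsX.
apply: leq_trans (leq_imset_card (fun p : T * T => [set p.1; p.2]) _).
apply: subset_leq_card; apply/subsetP => e; rewrite in_set => /andP[/edgesP[x [y [xy ->]]]].
rewrite subUset !sub1set => /andP[xA yA]; apply/imsetP.
have := bip x y xy; case: (boolP (x \in B)) => xB; case: (boolP (y \in B)) => yB // _.
  by exists (x, y); rewrite // !inE xA yA xB yB.
by exists (y, x); rewrite 1?setUC // !inE xA yA xB yB.
Qed.

(** A product with given sum is largest when balanced: with [h + k = a + b], the difference
    [h * k - a * b] equals [(h - a) * (k - a)], which is nonnegative for [a <= h <= k]. *)
Lemma leq_half_product a b : (a * b <= (a + b)./2 * uphalf (a + b))%N.
Proof.
have e := odd_double_half (a + b); have u := uphalf_half (a + b).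
move: e u; set h := (a + b)./2; set k := uphalf _ => e u.
have {}e : (h + k = a + b)%N by rewrite u addnCA addnn.
have {u} hk : (h <= k <= h.+1)%N by rewrite u leq_addl -[h.+1]add1n leq_add2r leq_b1.
move: h k e hk => h k.
wlog ah : a b / (a <= h)%N => [W e hk|e hk].
  case: (leqP a h) => [|ha] *; first exact: W.
  by rewrite mulnC; apply: W; rewrite 1?addnC //; move: e hk ha; clear; lia.
have De : (b = k + (h - a))%N by move: e ah; clear; lia.
by rewrite De -[X in (_ <= X * _)%N](subnK ah); nia.
Qed.

Lemma size_in_le_gamma A : (size_in G A <= gamma G #|A|)%N.
Proof.
rewrite /gamma; case: ifP => [/existsP[B /forallP bip]|_]; last exact: size_in_le.
apply: leq_trans (@size_in_product A B _) _.
  by move=> x y xy; have /forallP/(_ y)/implyP := bip x; apply.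
by rewrite -(cardsID B A); apply: leq_half_product.
Qed.

(** Deleting an endpoint of an edge inside [A] removes one vertex and at least one edge; repeating
    this ends at an independent set. *)
Lemma card_le_independence A : (#|A| <= independence_number G + size_in G A)%N.
Proof.
have [k] := ubnP #|A|; elim: k A => // k IH A /ltnSE le.
case: (boolP (independent G A)) => [ind|].
  by apply: leq_trans (leq_addr _ _); apply: (@leq_bigmax_cond _ _ (fun A : {set T} => #|A|)).
case/forall_inPn=> x xA /forall_inPn[y yA /negPn xy]; have xn : x \notin A :\ x by rewrite !inE eqxx.
rewrite -(setD1K xA) size_inU1 // cardsU1 xn.
have lt : (#|A :\ x| < k)%N by apply: leq_trans le; rewrite [X in (_ <= X)%N](cardsD1 x) xA.
have := IH _ lt.
rewrite (bigD1 y) /=; last by rewrite !inE yA eq_sym (adj_neq xy).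
by rewrite xy; lia.
Qed.

End Bounds.

(** * Expectation over random sets of order [c] *)

Section Expectation.
Variables (T : finType) (c : nat).
Hypothesis cn : (c <= #|T|)%N.
Implicit Types (f g : {set T} -> rat) (A : {set T}).

Lemma expect_eq f g : (forall A, #|A| = c -> f A = g A) -> expect c f = expect c g.
Proof. by move=> fg; congr (_ / _); apply: eq_bigr => A /eqP /fg. Qed.

Lemma expectD f g : expect c (fun A => f A + g A) = expect c f + expect c g.
Proof. by rewrite /expect big_split mulrDl. Qed.

Lemma expectZ a f : expect c (fun A => a * f A) = a * expect c f.
Proof. by rewrite /expect -mulr_sumr mulrA. Qed.

Lemma expect_sum (I : Type) (r : seq I) (P : pred I) (F : I -> {set T} -> rat) :
  expect c (fun A => \sum_(i <- r | P i) F i A) = \sum_(i <- r | P i) expect c (F i).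
Proof. by rewrite /expect exchange_big /= mulr_suml. Qed.

Lemma bin_card_neq0 : 'C(#|T|, c)%:R != 0 :> rat.
Proof. by rewrite pnatr_eq0 -lt0n bin_gt0. Qed.

Lemma expect_cst (a : rat) : expect c (fun _ : {set T} => a) = a.
Proof.
rewrite /expect sumr_const -(card_draws T c) -[X in X / _]mulr_natr.
have -> : #|[pred A : {set T} | #|A| == c]| = #|[set A : {set T} | #|A| == c]|.
  by apply: eq_card => A; rewrite inE.
by rewrite mulfK // (card_draws T c) bin_card_neq0.
Qed.

Lemma expect_ge0 f : (forall A, #|A| = c -> 0 <= f A) -> 0 <= expect c f.
Proof.
by move=> f0; rewrite divr_ge0 ?ler0n //; apply: sumr_ge0 => A /eqP /f0.
Qed.

Lemma expect_eq0 f : (forall A, #|A| = c -> 0 <= f A) ->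
  expect c f = 0 <-> (forall A, #|A| = c -> f A = 0).
Proof.
move=> f0; split=> [/eqP|h]; last by rewrite /expect big1 ?mul0r // => A /eqP /h.
rewrite mulf_eq0 invr_eq0 (negbTE bin_card_neq0) orbF psumr_eq0 => [|A /eqP /f0 //].
by move/allP=> h A /eqP cA; have := h A (mem_index_enum _); rewrite cA => /eqP.
Qed.

End Expectation.

Section Sizes.
Variables (T : finType) (G : graph T) (c : nat).
Hypotheses (c4 : (4 <= c)%N) (cn : (c + 4 <= #|T|)%N).
Hypotheses (nc : ~ complete G) (ncc : ~ cocomplete G).
Implicit Type A : {set T}.

Lemma c_le_card : (c <= #|T|)%N.
Proof. by apply: leq_trans cn; apply: leq_addr. Qed.

(** This replaces the probabilistic definition of the extreme sizes by actual vertex sets. *)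
Lemma prob_size_gt0 k : reflect (exists A : {set T}, #|A| = c /\ size_in G A = k)
  (0 < prob_size G c k).
Proof.
rewrite lt0r andbC expect_ge0 /=; last by move=> *; rewrite ler0n.
have h := expect_eq0 c_le_card (f := fun A => (size_in G A == k)%:R).
apply: (iffP idP) => [/eqP ne | [A [cA eA]]].
  case: (boolP [exists A : {set T}, (#|A| == c) && (size_in G A == k)]).
    by case/existsP=> A /andP[/eqP cA /eqP eA]; exists A.
  move/existsPn=> nA; case: ne; apply/h => [A _|A cA]; first by rewrite ler0n.
  by have := nA A; rewrite cA eqxx /= => /negbTE ->.
apply/eqP => /h H; have := H _ A cA; rewrite eA eqxx; move=> E.
by have := E (fun A _ => ler0n _ _).
Qed.

Lemma size_in_ub A : #|A| = c -> (size_in G A < 'C(c, 2).+1)%N.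
Proof. by move=> <-; rewrite ltnS size_in_le. Qed.

Lemma le_max_size A : #|A| = c -> (size_in G A <= max_size G c)%N.
Proof.
move=> cA; have := @leq_bigmax_cond _ (fun k : 'I__ => 0 < prob_size G c k)
  (fun k : 'I__ => k : nat) (Ordinal (size_in_ub cA)); apply.
by apply/prob_size_gt0; exists A.
Qed.

Lemma min_size_le A : #|A| = c -> (min_size G c <= size_in G A)%N.
Proof.
move=> cA; rewrite -leEnat.
have -> : min_size G c =
    \big[Order.min/'C(c, 2)]_(k < 'C(c, 2).+1 | 0 < prob_size G c k) (k : nat).
  by apply: (big_ind2 eq) => // m p q r -> ->; rewrite minEnat.
apply: (bigmin_le_cond _ (fun k : 'I_('C(c, 2).+1) => k : nat) (j := Ordinal (size_in_ub cA))).
by apply/prob_size_gt0; exists A.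
Qed.

Lemma exists_cset : exists A : {set T}, #|A| = c.
Proof.
by have [|A [cA _]] := @exists_set_avoiding T [::] c; [rewrite addn0 c_le_card | exists A].
Qed.

Lemma max_size_attained : exists A, #|A| = c /\ size_in G A = max_size G c.
Proof.
have [A0 cA0] := exists_cset.
have [|A /eqP cA mA] := @arg_maxnP _ A0 (fun A => #|A| == c) (size_in G); first exact/eqP.
exists A; split=> //; apply/eqP; rewrite eqn_leq le_max_size //=.
apply/bigmax_leqP => k /prob_size_gt0[B [/eqP cB <-]]; exact: mA.
Qed.

Lemma min_size_attained : exists A, #|A| = c /\ size_in G A = min_size G c.
Proof.
have [A0 cA0] := exists_cset.
have [|A /eqP cA mA] := @arg_minnP _ A0 (fun A => #|A| == c) (size_in G); first exact/eqP.
exists A; split=> //; apply/eqP; rewrite eqn_leq min_size_le // andbT.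
apply: (big_ind (fun m => (size_in G A <= m)%N)) => [|m p h1 h2|k].
(* The default value of the minimum is ['C(c, 2)], which no induced size exceeds. *)
- by rewrite -cA size_in_le.
- by rewrite leq_min h1.
- by case/prob_size_gt0=> B [/eqP cB <-]; exact: mA.
Qed.

End Sizes.

Section ExtremalSizes.
Variables (T : finType) (G : graph T).
Implicit Type A : {set T}.

Lemma size_in_eq0 A : (forall x y, x \in A -> y \in A -> ~~ G x y) -> size_in G A = 0%N.
Proof.
move=> h; apply/eqP; rewrite -leqn0 leqNgt; apply/negP => /size_in_gt0[x [y [xA yA]]].
exact/negP/h.
Qed.

Lemma size_in_star A : is_star G -> size_in G A = 0%N \/ size_in G A = #|A|.-1.
Proof.
case=> z hz; case: (boolP (z \in A)) => zA; [right|left].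
  have zn : z \notin A :\ z by rewrite !inE eqxx.
  rewrite -(setD1K zA) size_inU1 // size_in_eq0 => [|x y].
    rewrite cardsU1 zn add0n add1n -pred_Sn -sum1_card; apply: eq_bigr => p.
    by rewrite hz eqxx !inE eq_sym => /andP[-> _].
  by rewrite !inE hz => /andP[/negbTE -> _] /andP[/negbTE -> _]; rewrite andbF.
apply: size_in_eq0 => x y xA yA; rewrite hz.
have /negbTE -> : x != z by apply: contraNneq zA => <-.
by have /negbTE -> : y != z; [apply: contraNneq zA => <- | rewrite andbF].
Qed.

Lemma size_in_single_edge A : is_single_edge G -> size_in G A = 0%N \/ size_in G A = 1%N.
Proof.
case=> a [b [ab hG]].
suff : (size_in G A <= 1)%N by case: (size_in G A) => [|[|]] //; [left|right].
apply: leq_trans (subset_leq_card (_ : _ \subset [set [set a; b]])) _; last by rewrite cards1.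
apply/subsetP => e; rewrite in_set => /andP[/edgesP[x [y [xy ->]]] _]; rewrite in_set1.
by move: xy; rewrite hG => /orP[] /andP[/eqP -> /eqP ->] //; rewrite setUC.
Qed.

End ExtremalSizes.

(** Neither value of a star ([0], [c - 1]) nor of a single edge ([0], [1]) is the full size
    ['C(c, 2)]; this will exclude complements when some set has no edges. *)
Lemma bin2_gt c : (4 <= c)%N -> (maxn 1 c.-1 < 'C(c, 2))%N.
Proof.
case: c => // c c3; rewrite binS bin1 /=.
have : (0 < 'C(c, 2))%N by rewrite bin_gt0 ltnW.
by rewrite gtn_max; lia.
Qed.

Lemma extremal_two_sizes (T : finType) (G : graph T) (c : nat) : extremal G ->
  exists a b, forall A : {set T}, #|A| = c -> size_in G A = a \/ size_in G A = b.
Proof.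
case=> h.
- by exists 0%N, c.-1 => A <-; apply: size_in_star.
- by exists 0%N, 1%N => A _; apply: size_in_single_edge.
- exists 'C(c, 2), ('C(c, 2) - c.-1)%N => A <-.
  by have := size_in_compl G A; case: (size_in_star A h) => ->; lia.
- exists 'C(c, 2), ('C(c, 2) - 1)%N => A <-.
  by have := size_in_compl G A; case: (size_in_single_edge A h) => ->; lia.
Qed.

(** * Moment bounds and their equality cases *)

Section MomentBounds.
Variables (T : finType) (G : graph T) (c : nat).
Hypotheses (c4 : (4 <= c)%N) (cn : (c + 4 <= #|T|)%N).
Hypotheses (nc : ~ complete G) (ncc : ~ cocomplete G).
Implicit Type A : {set T}.

Let cT := c_le_card cn.
Local Notation S1 := (S1 G c).
Local Notation S2 := (S2 G c).
Local Notation V := (variance G c).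
Local Notation mn := ((min_size G c)%:R : rat).
Local Notation mx := ((max_size G c)%:R : rat).

Let expM : expect c (fun A => M G A) = S1. Proof. by []. Qed.
Let expV : expect c (fun A => (M G A - S1) ^+ 2) = V. Proof. by []. Qed.

Lemma expect_product (a b : rat) :
  expect c (fun A => (M G A - a) * (b - M G A)) = (S1 - a) * (b - S1) - V.
Proof.
(* The product is a part linear in [M] minus [(M - S1) ^+ 2], so only the mean and the variance
   survive. *)
rewrite (expect_eq (g := fun A => (b + a - 2 * S1) * M G A + (S1 ^+ 2 - a * b)
    + -1 * (M G A - S1) ^+ 2)) => [|A _]; last by ring.
rewrite expectD [X in X + _]expectD (expect_cst cT) !expectZ expM expV.
ring.
Qed.

Lemma varianceE : V = 2%:R * S2 - S1 * (S1 - 1).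
Proof.
rewrite /variance (expect_eq (g := fun A => M G A * (M G A - 1) + ((1 - 2 * S1) * M G A + S1 ^+ 2)))
  => [|A _]; last by ring.
rewrite expectD [X in _ + X]expectD (expect_cst cT) expectZ expM.
have -> : 2%:R * S2 = expect c (fun A => M G A * (M G A - 1)).
  by rewrite /Defs.S2 mulrA mulfV ?mul1r.
ring.
Qed.

Lemma min_leM A : #|A| = c -> mn <= M G A.
Proof. by move=> cA; rewrite ler_nat min_size_le. Qed.

Lemma M_le_max A : #|A| = c -> M G A <= mx.
Proof. by move=> cA; rewrite ler_nat le_max_size. Qed.

Lemma nonconstant k : ~ (forall A, #|A| = c -> size_in G A = k).
Proof.
move=> h; have [] // := @two_valued_constant _ G c k c4 cn.
by move=> A /h ->; left.
Qed.

(** If the nonnegative variable [M - mn] had mean zero, all sizes would be equal, which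
    [nonconstant] excludes. *)
Lemma min_lt_S1 : mn < S1.
Proof.
have h : 0 <= expect c (fun A => M G A + - mn).
  by apply: expect_ge0 => A cA; rewrite subr_ge0 min_leM.
have e : expect c (fun A => M G A + - mn) = S1 - mn by rewrite expectD (expect_cst cT).
rewrite -subr_gt0 -e lt0r h andbT; apply/eqP => /expect_eq0 H.
apply: (@nonconstant (min_size G c)) => A cA; apply/eqP; rewrite -(eqr_nat rat) -subr_eq0.
by apply/eqP/H => // B cB; rewrite subr_ge0 min_leM.
Qed.

Lemma S1_lt_max : S1 < mx.
Proof.
have h : 0 <= expect c (fun A => mx + -1 * M G A).
  by apply: expect_ge0 => A cA; rewrite mulN1r subr_ge0 M_le_max.
have e : expect c (fun A => mx + -1 * M G A) = mx - S1.
  by rewrite expectD expectZ (expect_cst cT) mulN1r.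
rewrite -subr_gt0 -e lt0r h andbT; apply/eqP => /expect_eq0 H.
apply: (@nonconstant (max_size G c)) => A cA; apply/eqP.
rewrite eq_sym -(eqr_nat rat) -subr_eq0 -mulN1r.
by apply/eqP/H => // B cB; rewrite mulN1r subr_ge0 M_le_max.
Qed.

Lemma S1_gt0 : 0 < S1.
Proof. by apply: le_lt_trans min_lt_S1; rewrite ler0n. Qed.

Lemma product_ge0 a b : a <= mn -> mx <= b ->
  forall A, #|A| = c -> 0 <= (M G A - a) * (b - M G A).
Proof.
move=> am mb A cA; apply: mulr_ge0; rewrite subr_ge0.
  exact: le_trans am (min_leM cA).
exact: le_trans (M_le_max cA) mb.
Qed.

Lemma variance_le a b : a <= mn -> mx <= b -> V <= (S1 - a) * (b - S1).
Proof.
by move=> am mb; rewrite -subr_ge0 -expect_product; apply/expect_ge0/product_ge0.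
Qed.

Lemma variance_eq a b : a <= mn -> mx <= b ->
  (V = (S1 - a) * (b - S1) <-> forall A, #|A| = c -> (M G A - a) * (b - M G A) = 0).
Proof.
move=> am mb; rewrite -(expect_eq0 cT); last exact: product_ge0.
rewrite expect_product; split=> [->|/eqP]; first by rewrite subrr.
by rewrite subr_eq0 => /eqP.
Qed.

Lemma lower_bound_le a : a <= mn -> S1 + V / (S1 - a) <= mx.
Proof.
move=> am; have aS : 0 < S1 - a by rewrite subr_gt0; apply: le_lt_trans am min_lt_S1.
by rewrite -lerBrDl ler_pdivrMr // mulrC; apply: variance_le.
Qed.

Lemma lower_bound_eq a : a <= mn ->
  (mx = S1 + V / (S1 - a) <-> forall A, #|A| = c -> (M G A - a) * (mx - M G A) = 0).
Proof.
move=> am; have aS : S1 - a != 0.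
  by rewrite gt_eqF // subr_gt0; apply: le_lt_trans am min_lt_S1.
rewrite -variance_eq //; split=> [->|->]; first by field.
by field.
Qed.

Lemma upper_bound_ge b : mx <= b -> mn <= S1 - V / (b - S1).
Proof.
move=> mb; have bS : 0 < b - S1 by rewrite subr_gt0; apply: lt_le_trans S1_lt_max mb.
by rewrite lerBrDr addrC -lerBrDr ler_pdivrMr //; apply: variance_le.
Qed.

Lemma upper_bound_eq b : mx <= b ->
  (mn = S1 - V / (b - S1) <-> forall A, #|A| = c -> (M G A - mn) * (b - M G A) = 0).
Proof.
move=> mb; have bS : b - S1 != 0.
  by rewrite gt_eqF // subr_gt0; apply: lt_le_trans S1_lt_max mb.
rewrite -variance_eq //; split=> [->|->]; first by field.
by field.
Qed.

(** The first term is thus the parametric bound at 0, and [lower_bound_le] covers both terms. *)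
Lemma first_lower_term : 2%:R * S2 / S1 + 1 = S1 + V / (S1 - 0).
Proof. by rewrite varianceE; field; rewrite gt_eqF // S1_gt0. Qed.

Lemma lower_minE (ls : int) : 0 <= ls -> ls <= (min_size G c)%:Z ->
  lower_min G c ls = S1 + V / (S1 - 0) /\ lower_max G c ls = S1 + V / (S1 - ls%:~R).
Proof.
move=> ls0 lsm; rewrite /lower_min /lower_max first_lower_term.
suff h : S1 + V / (S1 - 0) <= S1 + V / (S1 - ls%:~R) by rewrite min_l ?max_r.
have lsS : 0 < S1 - ls%:~R.
  by rewrite subr_gt0; apply: le_lt_trans min_lt_S1; rewrite -[mn]/((min_size G c)%:Z%:~R) ler_int.
rewrite lerD2l ler_wpM2l //.
  by apply: expect_ge0 => A _; rewrite sqr_ge0.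
by rewrite lef_pV2 ?posrE ?subr0 ?S1_gt0 // gerBl ler0z.
Qed.

Lemma has_subgraph_ge_bound (z : rat) : z <= mx -> has_subgraph_ge G c (Num.ceil z).
Proof.
move=> zm; have [A [cA eA]] := max_size_attained G cn.
by exists A; split=> //; rewrite eA ceil_le_int.
Qed.

Lemma has_subgraph_le_bound (z : rat) : mn <= z -> has_subgraph_le G c (Num.floor z).
Proof.
move=> zm; have [A [cA eA]] := min_size_attained G cn.
by exists A; split=> //; rewrite eA floor_ge_int.
Qed.

(** Negative [ls] is allowed because [c - a] can be negative. The order of the two terms is then not
    fixed, so each is bounded by the maximum separately. *)
Lemma subgraph_lower (ls : int) : ls <= (min_size G c)%:Z ->
  has_subgraph_ge G c (Num.ceil (lower_min G c ls)) /\
  has_subgraph_ge G c (Num.ceil (lower_max G c ls)).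
Proof.
move=> lsm; rewrite /lower_min /lower_max first_lower_term.
have h0 : S1 + V / (S1 - 0) <= mx by apply: lower_bound_le; rewrite ler0n.
have h1 : S1 + V / (S1 - ls%:~R) <= mx by apply: lower_bound_le; rewrite -(ler_int rat) in lsm.
by split; apply: has_subgraph_ge_bound; rewrite ?ge_min ?ge_max ?h0 ?h1.
Qed.

Lemma subgraph_upper (us : int) : (max_size G c)%:Z <= us ->
  has_subgraph_le G c (Num.floor (upper G c us)).
Proof.
by move=> usm; apply/has_subgraph_le_bound/upper_bound_ge; rewrite -(ler_int rat) in usm.
Qed.

(** The structure theorem gives one direction with gap [max_size - min_size]. Conversely, the two
    sizes of an extremal graph must be the minimum and the maximum, as these are distinct and
    attained. *)
Lemma two_sizes_extremal :
  (forall A, #|A| = c -> (M G A - mn) * (mx - M G A) = 0) <-> extremal G.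
Proof.
have [Am [cAm eAm]] := min_size_attained G cn; have [Ax [cAx eAx]] := max_size_attained G cn.
have lt : (min_size G c < max_size G c)%N.
  by rewrite -(ltr_nat rat); apply: lt_trans min_lt_S1 S1_lt_max.
split=> [h|/(extremal_two_sizes c)[a [b h]] A cA].
  have tv : two_valued G c (min_size G c) (max_size G c - min_size G c).
    move=> A cA; have /eqP := h A cA; rewrite mulf_eq0 !subr_eq0 !eqr_nat.
    by rewrite (subnKC (ltnW lt)) eq_sym => /orP[]/eqP->; [left|right].
  by apply: (two_valued_extremal nc ncc c4 cn _ tv); exists Ax; rewrite subnKC // ltnW.
apply/eqP; rewrite mulf_eq0 !subr_eq0 !eqr_nat.
have := h A cA; have := h _ cAm; have := h _ cAx; rewrite eAm eAx.
by move: lt; clear; move: (size_in G A) (max_size G c) (min_size G c); lia.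
Qed.

(** As the sizes are not constant, the minimum must be 0. A set without edges is complete in
    [compl G], so by [bin2_gt] the complement is neither a star nor a single edge. *)
Lemma zero_or_max_star :
  (forall A, #|A| = c -> (M G A - 0) * (mx - M G A) = 0) <-> is_star G \/ is_single_edge G.
Proof.
have [Ax [cAx eAx]] := max_size_attained G cn.
have lt : (min_size G c < max_size G c)%N.
  by rewrite -(ltr_nat rat); apply: lt_trans min_lt_S1 S1_lt_max.
split=> [h|st A cA].
  have h' A : #|A| = c -> size_in G A = 0%N \/ size_in G A = max_size G c.
    move=> cA; have /eqP := h A cA; rewrite subr0 mulf_eq0 !subr_eq0 !eqr_nat pnatr_eq0.
    by rewrite [_ == size_in G A]eq_sym => /orP[]/eqP->; [left|right].
  have [A0 [cA0 eA0]] : exists A, #|A| = c /\ size_in G A = 0%N.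
    have [Am [cAm eAm]] := min_size_attained G cn; exists Am; split=> //.
    by case: (h' _ cAm) => // E; move: lt; rewrite -eAm E ltnn.
  have tv : two_valued G c 0 (max_size G c) by [].
  have c2 := bin2_gt c4; rewrite gtn_max in c2.
  have := size_in_compl G A0; rewrite eA0 cA0 add0n => full.
  case: (two_valued_extremal nc ncc c4 cn _ tv) => //; [by exists Ax|by left|by right|..] => k.
    by case: (size_in_star A0 k); rewrite full ?cA0 => E; move: c2; rewrite E ?ltnn ?andbF.
  by case: (size_in_single_edge A0 k); rewrite full => E; move: c2; rewrite E ?ltnn ?andbF.
apply/eqP; rewrite subr0 mulf_eq0 subr_eq0 !eqr_nat pnatr_eq0.
have [b h] : exists b, forall A, #|A| = c -> size_in G A = 0%N \/ size_in G A = b.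
  case: st => st; first by exists c.-1 => B <-; apply: size_in_star.
  by exists 1%N => B _; apply: size_in_single_edge.
have := h A cA; have := h _ cAx; rewrite eAx.
by move: lt; clear; move: (size_in G A) (max_size G c) (min_size G c); lia.
Qed.

End MomentBounds.

(** * The first two moments *)

(** The sum of ['C(k, 2)] over the multiplicities [k] of the entries. The recursion mirrors the
    counting loop, which reads its list from the end and adds the current counter at each entry. *)
Fixpoint equal_pairs (X : eqType) (w : seq X) : nat :=
  if w is x :: w' then (count_mem x w' + equal_pairs w')%N else 0%N.

Lemma equal_pairs_map (X Y : eqType) (f : X -> Y) (w : seq X) : injective f ->
  equal_pairs (map f w) = equal_pairs w.
Proof.
move=> fI; elim: w => //= x w ->; congr addn; rewrite count_map.
by apply: eq_count => y; rewrite /= inj_eq.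
Qed.

(** Summing [k ^ 2 = 2 'C(k, 2) + k] over the multiplicities [k]. *)
Lemma sum_count_sqr (X : finType) (w : seq X) :
  (\sum_(v : X) count_mem v w ^ 2 = (equal_pairs w).*2 + size w)%N.
Proof.
elim: w => [|x w IH]; first by rewrite big1.
rewrite /= (eq_bigr (fun v => (count_mem v w ^ 2 + (v == x) * (count_mem v w).*2 + (v == x))%N)).
  rewrite !big_split /= IH (bigD1 x) //= eqxx mul1n big1 => [|v /negbTE -> //].
  rewrite (bigD1 x) //= eqxx big1 => [|v /negbTE -> //].
  by rewrite doubleD; lia.
by move=> v _; rewrite eq_sym; case: eqP => _; rewrite ?add0n ?mul0n ?addn0 //=; nia.
Qed.

Section Moments.
Variables (T : finType) (G : graph T) (c : nat).
Hypotheses (c4 : (4 <= c)%N) (cn : (c + 4 <= #|T|)%N).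

Let cT := c_le_card cn.
Local Notation n := #|T|.
Local Notation m := (gsize G).

(** The probability that a random set of order [c] contains [j] given vertices. *)
Definition incl_prob (j : nat) : rat := 'C(n - j, c - j)%:R / 'C(n, c)%:R.

Lemma expect_subset (X : {set T}) : (#|X| <= c)%N ->
  expect c (fun A => (X \subset A)%:R) = incl_prob #|X|.
Proof.
move=> Xc; congr (_ / _); rewrite -natr_sum -big_mkcondr /= sum1_card; congr _%:R.
have -> : (n - #|X| = #|~: X|)%N by rewrite [RHS]cardsCs setCK.
rewrite -(cards_draws (~: X)) -[RHS](@card_in_imset _ _ (fun B => X :|: B)) => [|B C].
  apply: eq_card => A; rewrite unfold_in; apply/andP/imsetP => [[/eqP cA XA]|[B]].
    exists (A :\: X); last by rewrite setDE setUIr setUCr setIT; apply/esym/setUidPr.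
    rewrite inE cardsD (setIidPr XA) cA eqxx andbT.
    by rewrite setDE subsetIr.
  rewrite inE => /andP[BX /eqP cB] ->; rewrite subsetUl; split=> //.
  rewrite cardsU cB; have -> : X :&: B = set0.
    by apply/eqP; rewrite setIC setI_eq0 disjoints_subset.
  by rewrite cards0 subn0 subnKC.
rewrite !inE => /andP[BX _] /andP[CX _] E.
have h (Z : {set T}) : Z \subset ~: X -> Z = (X :|: Z) :\: X.
  move=> ZX; rewrite setDE setIUl setICr set0U; apply/esym/setIidPl; exact: ZX.
by rewrite (h B) // (h C) // E.
Qed.

Lemma incl_prob0 : incl_prob 0 = 1.
Proof. by rewrite /incl_prob !subn0 divff // bin_card_neq0. Qed.

Lemma incl_probS j : (j < c)%N ->
  incl_prob j.+1 * (n%:R - j%:R) = incl_prob j * (c%:R - j%:R).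
Proof.
move=> jc; have jn : (j < n)%N by apply: leq_trans jc cT.
rewrite /incl_prob -!natrB 1?ltnW // mulrAC [RHS]mulrAC; congr (_ / _).
rewrite -!natrM; congr _%:R; rewrite mulnC [RHS]mulnC.
have := mul_bin_diag (n - j) (c - j.+1).
by rewrite -subnS -subSn // subSS.
Qed.

Lemma card_sub_neq0 j : (j < 4)%N -> n%:R - j%:R != 0 :> rat.
Proof.
move=> j4; rewrite subr_eq0 eqr_nat gtn_eqF //.
by apply: leq_trans j4 (leq_trans _ cn); apply: leq_addl.
Qed.

Lemma incl_prob_falling j : (j <= 4)%N ->
  incl_prob j = \prod_(i < j) ((c%:R - i%:R) / (n%:R - i%:R)).
Proof.
elim: j => [|j IH] j4; first by rewrite big_ord0 incl_prob0.
rewrite big_ord_recr /= -IH 1?ltnW // mulrA -incl_probS; last exact: leq_trans c4.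
by rewrite mulfK // card_sub_neq0.
Qed.

Definition sum_deg_sqr : nat := (\sum_(v : T) #|[set e in edges G | v \in e]| ^ 2)%N.

(** Double counting of triples of two edges and a common vertex. *)
Lemma sum_cardI : (\sum_(e in edges G) \sum_(f in edges G) #|e :&: f|)%N = sum_deg_sqr.
Proof.
rewrite /sum_deg_sqr.
transitivity (\sum_(e in edges G) \sum_(f in edges G) \sum_(v : T) (v \in e) * (v \in f))%N.
  apply: eq_bigr => e _; apply: eq_bigr => f _.
  rewrite -sum1_card big_mkcond; apply: eq_bigr => v _; rewrite inE.
  by case: (v \in e); case: (v \in f).
under eq_bigr do rewrite exchange_big.
rewrite exchange_big /=; apply: eq_bigr => v _.
have -> : #|[set e in edges G | v \in e]| = (\sum_(e in edges G) (v \in e))%N.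
  by rewrite -big_mkcondr -sum1_card; apply: eq_bigl => e; rewrite in_set.
rewrite -mulnn big_distrl; apply: eq_bigr => e _.
by rewrite big_distrr.
Qed.

Lemma M_sum A : M G A = \sum_(e in edges G) (e \subset A)%:R.
Proof.
rewrite /M /size_in -natr_sum -big_mkcondr -sum1_card; congr _%:R.
by apply: eq_bigl => e; rewrite in_set.
Qed.

Lemma S1_formula : S1 G c = m%:R * incl_prob 2.
Proof.
rewrite /S1 (expect_eq (g := fun A => \sum_(e in edges G) (e \subset A)%:R)) => [|A _].
  rewrite expect_sum (eq_bigr (fun=> incl_prob 2)) => [|e eE].
    by rewrite sumr_const mulr_natl.
  by rewrite expect_subset (card_edge eE) // ltnW // ltnW.
exact: M_sum.
Qed.

(** The union has [4 - #|e :&: f|] vertices. The formula is linear in the intersection for 0 and 1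
    common vertices, and its last term corrects the value for 2, that is for [e = f]. *)
Lemma expect_subset2 e f : e \in edges G -> f \in edges G ->
  expect c (fun A => (e \subset A)%:R * (f \subset A)%:R) =
    incl_prob 4 + #|e :&: f|%:R * (incl_prob 3 - incl_prob 4)
    + (e == f)%:R * (incl_prob 2 - 2%:R * incl_prob 3 + incl_prob 4).
Proof.
move=> eE fE; have ce := card_edge eE; have cf := card_edge fE.
rewrite (expect_eq (g := fun A => (e :|: f \subset A)%:R)) => [|A _]; last first.
  by rewrite subUset; do 2!case: (_ \subset _); rewrite ?mulr0 ?mulr1.
have cU : #|e :|: f| = (4 - #|e :&: f|)%N by rewrite cardsU ce cf.
rewrite expect_subset; last by rewrite cU (leq_trans (leq_subr _ _)).
have sIe := subset_leq_card (subsetIl e f); rewrite ce in sIe.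
case: (eqVneq e f) cU => [Def|ef].
  by subst f; rewrite setIid ce => ->; rewrite mul1r; ring.
case E: #|e :&: f| sIe => [|[|[|k]]] //= _ ->; try ring.
case/eqP: ef; apply/eqP.
have eIe : e :&: f = e by apply/eqP; rewrite eqEcard subsetIl ce E.
by rewrite eqEcard ce cf leqnn andbT -{1}eIe subsetIr.
Qed.

(** The diagonal terms [e = f] contribute [m * incl_prob 2], which cancels against the mean
    subtracted in [M * (M - 1)]. *)
Lemma S2_formula : 2%:R * S2 G c =
  m%:R ^+ 2 * incl_prob 4 + sum_deg_sqr%:R * (incl_prob 3 - incl_prob 4)
  + m%:R * (incl_prob 4 - 2%:R * incl_prob 3).
Proof.
rewrite /S2 mulrA mulfV // mul1r.
rewrite (expect_eq (g := fun A => (\sum_(e in edges G) \sum_(f in edges G)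
    (e \subset A)%:R * (f \subset A)%:R) + -1 * M G A)) => [|A _]; last first.
  rewrite mulrBr mulr1 mulN1r; congr (_ - _).
  by rewrite M_sum mulr_suml; apply: eq_bigr => e _; rewrite mulr_sumr.
rewrite expectD expectZ -/(S1 G c) S1_formula expect_sum.
transitivity (\sum_(e in edges G) \sum_(f in edges G)
    (incl_prob 4 + #|e :&: f|%:R * (incl_prob 3 - incl_prob 4)
    + (e == f)%:R * (incl_prob 2 - 2%:R * incl_prob 3 + incl_prob 4)) + -1 * (m%:R * incl_prob 2)).
  congr (_ + _); apply: eq_bigr => e eE; rewrite expect_sum; apply: eq_bigr => f fE.
  exact: expect_subset2.
have one (e : {set T}) : e \in edges G -> \sum_(f in edges G) (e == f)%:R = 1 :> rat.
  move=> eE; rewrite (bigD1 e eE) /= eqxx big1 ?addr0 // => f /andP[_ fe].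
  by rewrite eq_sym (negbTE fe).
under eq_bigr => e eE.
  rewrite !big_split /= sumr_const -!mulr_suml (one e eE) -natr_sum; over.
rewrite !big_split /= -!mulr_suml -natr_sum sum_cardI !sumr_const.
rewrite -/(gsize G); ring.
Qed.

End Moments.

Definition endpoints (T : Type) (es : seq (T * T)) : seq T :=
  flatten [seq [:: e.1; e.2] | e <- es].

Section EdgeList.
Variables (T : finType) (G : graph T) (es : seq (T * T)).
Hypothesis esG : edge_list G es.

Lemma size_edge_list : size es = gsize G.
Proof. by rewrite -(size_map (fun e => [set e.1; e.2])) (perm_size esG) -cardE. Qed.

Lemma size_endpoints : size (endpoints es) = (gsize G).*2.
Proof.
by rewrite -size_edge_list /endpoints; elim: es => //= e s ->.
Qed.

(** As the ends of an edge differ, it contributes at most one occurrence of [v]; the multiplicities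
    are the degrees. *)
Lemma count_endpoints v : count_mem v (endpoints es) = #|[set e in edges G | v \in e]|.
Proof.
have -> : #|[set e in edges G | v \in e]| = (\sum_(e <- enum (edges G)) (v \in e))%N.
  by rewrite big_enum -big_mkcondr -sum1_card; apply: eq_bigl => e; rewrite in_set.
rewrite -(perm_big _ esG) big_map.
have : all (fun e : T * T => e.1 != e.2) es.
  apply/allP=> e ees; have : [set e.1; e.2] \in enum (edges G).
    by rewrite -(perm_mem esG); apply: map_f.
  by rewrite mem_enum edges_set2; apply: adj_neq.
rewrite /endpoints; elim: es => [|e s IH] /=; first by rewrite big_nil.
case/andP=> e12 /IH {}IH; rewrite big_cons -IH !inE ![v == _]eq_sym addnA; congr addn.
by case: (eqVneq e.1 v) e12 => [->|_] //; rewrite eq_sym => /negbTE ->.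
Qed.

Lemma sum_deg_sqr_pairs : sum_deg_sqr G = ((equal_pairs (endpoints es)).*2 + (gsize G).*2)%N.
Proof.
rewrite -size_endpoints -sum_count_sqr; apply: eq_bigr => v _.
by rewrite count_endpoints.
Qed.

End EdgeList.

(** * Integer formulas for the moments and rounding *)

Definition falling4 (n : int) : int := n * (n - 1) * (n - 2) * (n - 3).

Definition S1_num (n m c : int) : int := m * (c * (c - 1)) * ((n - 2) * (n - 3)).

(** With [P] the number of pairs of edges sharing a vertex, [2 * P] ordered pairs span three
    vertices and the other [m * (m - 1) - 2 * P] span four. Both terms are put over the denominator
    [falling4 n]. *)
Definition S2_num (n m c P : int) : int :=
  c * (c - 1) * (c - 2) * (2 * P * (n - 3) + (m * (m - 1) - 2 * P) * (c - 3)).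

Lemma ceil_div (x y : int) : 0 < y -> Num.ceil (x%:~R / y%:~R : rat) = - ((- x) %/ y)%Z.
Proof.
move=> y0; apply/eqP; rewrite ceil_eq.
have y0' : (0 : rat) < y%:~R by rewrite ltr0z.
rewrite ltr_pdivlMr // ler_pdivrMr // -!intrM ltr_int ler_int.
have := divz_eq (- x) y; have := modz_ge0 (- x) (lt0r_neq0 y0); have := ltz_pmod (- x) y0.
move: (_ %/ _)%Z (_ %% _)%Z => q r; nia.
Qed.

Lemma floor_div (x y : int) : 0 < y -> Num.floor (x%:~R / y%:~R : rat) = (x %/ y)%Z.
Proof.
move=> y0; apply/eqP; rewrite floor_eq.
have y0' : (0 : rat) < y%:~R by rewrite ltr0z.
rewrite ltr_pdivrMr // ler_pdivlMr // -!intrM ltr_int ler_int.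
have := divz_eq x y; have := modz_ge0 x (lt0r_neq0 y0); have := ltz_pmod x y0.
move: (_ %/ _)%Z (_ %% _)%Z => q r; nia.
Qed.

Lemma ceil_min (x y : rat) : Num.ceil (Num.min x y) = Num.min (Num.ceil x) (Num.ceil y).
Proof.
case: (leP x y) => [xy|/ltW yx]; first by rewrite min_l // le_ceil.
by rewrite min_r // le_ceil.
Qed.

Lemma ceil_max (x y : rat) : Num.ceil (Num.max x y) = Num.max (Num.ceil x) (Num.ceil y).
Proof.
case: (leP x y) => [xy|/ltW yx]; first by rewrite max_r // le_ceil.
by rewrite max_l // le_ceil.
Qed.

Section Rounding.
Variables (T : finType) (G : graph T) (c P : nat).
Hypotheses (c4 : (4 <= c)%N) (cn : (c + 4 <= #|T|)%N).
Hypotheses (nc : ~ complete G) (ncc : ~ cocomplete G).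
Hypothesis DP : sum_deg_sqr G = (P.*2 + (gsize G).*2)%N.

Let n : int := #|T|%:Z.
Let m : int := (gsize G)%:Z.
Let A := S1_num n m c%:Z.
Let B := S2_num n m c%:Z P%:Z.
Let D := falling4 n.

Lemma falling4_gt0 : 0 < D.
Proof.
have n8 : 8 <= n by rewrite /n; move: c4 cn; clear; lia.
by rewrite /D /falling4 !mulr_gt0 // ?subr_gt0 ?(lt_le_trans _ n8).
Qed.

Lemma incl_prob_ratio :
  let i := (D%:~R : rat)^-1 in let d j := (n - j)%:~R : rat in
  let k : int -> rat := fun j => (c%:Z - j)%:~R in
  [/\ incl_prob T c 2 = k 0 * k 1 * d 2 * d 3 * i,
      incl_prob T c 3 = k 0 * k 1 * k 2 * d 3 * i
    & incl_prob T c 4 = k 0 * k 1 * k 2 * k 3 * i].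
Proof.
move=> i d k.
have fall j : (j <= 4)%N -> incl_prob T c j = \prod_(l < j) (k l%:Z / d l%:Z).
  move=> j4; rewrite incl_prob_falling //; apply: eq_bigr => l _.
  by rewrite /k /d !intrB -!pmulrn.
have d0 j : (j < 4)%N -> d j%:Z != 0.
  by move=> j4; rewrite /d intrB -!pmulrn (card_sub_neq0 cn).
have Di : i = (d 0 * d 1 * d 2 * d 3)^-1.
  by rewrite /i /d /D /falling4 !intrM subr0.
have := d0 0%N isT; have := d0 1%N isT; have := d0 2%N isT; have := d0 3%N isT.
rewrite !fall // !big_ord_recl !big_ord0 /= /bump /= Di.
move: (d 0) (d 1) (d 2) (d 3) (k 0) (k 1) (k 2) (k 3) => x0 x1 x2 x3 y0 y1 y2 y3.
by move=> h3 h2 h1 h0; split; field; rewrite ?h0 ?h1 ?h2 ?h3.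
Qed.

Lemma S1_ratio : S1 G c = A%:~R / D%:~R.
Proof.
rewrite (S1_formula G c4); have [-> _ _] := incl_prob_ratio.
rewrite /A /S1_num !intrM !subr0 pmulrn; ring.
Qed.

Lemma S2_ratio : 2%:R * S2 G c = B%:~R / D%:~R.
Proof.
rewrite (S2_formula G c4) DP; have [_ -> ->] := incl_prob_ratio.
rewrite /B /S2_num -!muln2 natrD !natrM !subr0.
rewrite !pmulrn -/m.
move: (n - 3) (n - 2) (_%:~R^-1) => n3 n2 i.
ring.
Qed.

End Rounding.

(** * Linear-time computation of the bounds *)

Inductive expr :=
| Lit of int
| Get of expr
| Bin of binop & expr & expr.

Fixpoint eval (s : Defs.mem) (e : expr) : int :=
  match e with
  | Lit v => v
  | Get e => s (eval s e)
  | Bin o e1 e2 => eval_binop o (eval s e1) (eval s e2)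
  end.

(* The value of [e] is left in cell [r]; the cells below [r] are scratch. *)
Fixpoint compile (r : int) (e : expr) : cmd :=
  match e with
  | Lit v => Const r v
  | Get e => Seq (compile r e) (Read r r)
  | Bin o e1 e2 => Seq (compile r e1) (Seq (compile (r - 1) e2) (Op o r r (r - 1)))
  end.

Fixpoint cost (e : expr) : nat :=
  match e with
  | Lit _ => 1
  | Get e => cost e + 1
  | Bin _ e1 e2 => cost e1 + (cost e2 + 1)
  end.

(* Cells up to [scratch] hold intermediate values; programs keep their data
   above it. *)
Definition scratch : int := -10.

(** Addresses lie above [scratch], so evaluation ignores scratch cells. The exponent 6 comes from
    the pair count, at most [(2m)^2] with [2m <= N^3]. *)
Fixpoint safe (N : nat) (s : Defs.mem) (e : expr) : Prop :=
  match e with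
  | Lit v => (`|v| <= N ^ 6)%N
  | Get e => [/\ safe N s e, scratch < eval s e & (`|s (eval s e)| <= N ^ 6)%N]
  | Bin _ e1 e2 => safe N s e1 /\ safe N s e2
  end.

(** An exponent of [N] bounding every intermediate value. The maximum also covers the address of a
    read, which is written to memory; the successor pays the factor 2 of a sum. *)
Fixpoint deg (e : expr) : nat :=
  match e with
  | Lit _ => 6
  | Get e => maxn 6 (deg e)
  | Bin _ e1 e2 => (deg e1 + deg e2).+1
  end.

Definition agree (s s' : Defs.mem) : Prop := forall b, scratch < b -> s b = s' b.

Lemma agree_refl s : agree s s. Proof. by []. Qed.

Lemma eval_agree N s s' e : agree s s' -> safe N s e ->
  eval s' e = eval s e /\ safe N s' e.
Proof.
move=> ss'; elim: e => [v|e IH|o e1 IH1 e2 IH2] //=.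
  by case=> /IH[-> se] le bd; rewrite -(ss' _ le); split.
by case=> /IH1[-> s1] /IH2[-> s2].
Qed.

Lemma absz_binop (N : nat) o (x y : int) a b : (2 <= N)%N ->
  (`|x| <= N ^ a)%N -> (`|y| <= N ^ b)%N -> (`|eval_binop o x y| <= N ^ (a + b).+1)%N.
Proof.
move=> N2 xa yb.
have N0 : (0 < N)%N by apply: leq_trans N2.
have ga : (0 < N ^ a)%N by rewrite expn_gt0 N0.
have gb : (0 < N ^ b)%N by rewrite expn_gt0 N0.
rewrite expnS expnD.
have sum_le : (`|x| + `|y| <= N * (N ^ a * N ^ b))%N.
  apply: leq_trans (leq_mul N2 (leqnn _)).
  by move: (N ^ a)%N (N ^ b)%N ga gb xa yb => p q; clear; nia.
have mul_le : (`|x| * `|y| <= N * (N ^ a * N ^ b))%N.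
  by apply: leq_trans (leq_mul xa yb) _; apply: leq_pmull.
case: o => /=.
- by apply: leq_trans sum_le; clear; lia.
- by apply: leq_trans sum_le; clear; lia.
- by rewrite abszM.
- have /(_ x y) h := lez_div; apply: leq_trans sum_le; apply: leq_trans (leq_addr _ _).
  by rewrite -lez_nat !abszE.
Qed.

Lemma absz_eval N s e : (2 <= N)%N -> safe N s e -> (`|eval s e| <= N ^ deg e)%N.
Proof.
move=> N2; elim: e => [v|e IH|o e1 IH1 e2 IH2] //=.
  case=> _ _ h; apply: leq_trans h _; apply: leq_pexp2l; last exact: leq_maxl.
  exact: leq_trans N2.
by case=> /IH1 h1 /IH2 h2; apply: absz_binop.
Qed.

(** * Compiled expressions on the word RAM *)

Section Programs.
Variables (N K : nat).
Hypothesis N2 : (2 <= N)%N.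
Local Notation W := (N ^ K)%N.

Lemma le_word k x : (k <= K)%N -> (x <= N ^ k)%N -> (x <= W)%N.
Proof. by move=> kK xk; apply: leq_trans xk _; rewrite leq_pexp2l // ltnW. Qed.

Lemma compile_exec r e s : r <= scratch -> safe N s e -> (deg e <= K)%N ->
  exists s', [/\ exec W (compile r e) s (cost e) s', s' r = eval s e
    & forall b, r < b -> s' b = s b].
Proof.
elim: e r s => [v|e IH|o e1 IH1 e2 IH2] r s rs /=.
- move=> hv K6; exists (upd s r v); split.
  + by apply: ExConst; apply: le_word hv.
  + by rewrite /upd eqxx.
  + by move=> b rb; rewrite /upd gt_eqF.
- case=> se lt bd; rewrite geq_max => /andP[K6 Ke].
  have [s1 [ex1 v1 fr1]] := IH r s rs se Ke.
  have E : s1 (s1 r) = s (eval s e) by rewrite v1 fr1 // (le_lt_trans rs).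
  exists (upd s1 r (s1 (s1 r))); split.
  + by apply: ExSeq ex1 _; apply: ExRead; rewrite E; apply: le_word bd.
  + by rewrite /upd eqxx E.
  + by move=> b rb; rewrite /upd gt_eqF // fr1.
- case=> se1 se2 dK.
  have d1 : (deg e1 <= K)%N by apply: leq_trans dK; rewrite ltnW // ltnS leq_addr.
  have d2 : (deg e2 <= K)%N by apply: leq_trans dK; rewrite ltnW // ltnS leq_addl.
  have [s1 [ex1 v1 fr1]] := IH1 r s rs se1 d1.
  have ag : agree s s1 by move=> b sb; rewrite fr1 // (le_lt_trans rs).
  have [ev2 se2'] := eval_agree ag se2.
  have rs' : r - 1 <= scratch by apply: le_trans rs; rewrite gerBl.
  have [s2 [ex2 v2 fr2]] := IH2 (r - 1) s1 rs' se2' d2.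
  have E : s2 r = eval s e1 by rewrite fr2 ?v1 // ltrBlDr ltrDl.
  exists (upd s2 r (eval_binop o (s2 r) (s2 (r - 1)))); split.
  + apply: ExSeq ex1 _; apply: ExSeq ex2 _; apply: ExOp.
    rewrite E v2 ev2; apply: le_word dK _.
    by apply: absz_binop => //; apply: absz_eval.
  + by rewrite /upd eqxx E v2 ev2.
  + move=> b rb; rewrite /upd gt_eqF // fr2 ?fr1 //.
    by apply: lt_trans rb; rewrite gtrBl.
Qed.

(* Scratch cells are ignored on both sides, so that runs compose. *)
Definition runs (p : cmd) (s : Defs.mem) (t : nat) (s' : Defs.mem) : Prop :=
  forall s1, agree s s1 -> exists s2, exec W p s1 t s2 /\ agree s' s2.

Lemma runs_seq p q s t s' t' s'' :
  runs p s t s' -> runs q s' t' s'' -> runs (Seq p q) s (t + t') s''.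
Proof.
move=> rp rq s1 /rp[s2 [ex2 /rq[s3 [ex3 ag]]]]; exists s3; split=> //.
exact: ExSeq ex2 ex3.
Qed.

(** The language has no direct move, so the value is added to a zero. Evaluating in scratch first
    lets [e] mention [a] itself. *)
Definition assign (a : int) (e : expr) : cmd :=
  Seq (compile scratch e) (Seq (Const (scratch - 1) 0) (Op Add a scratch (scratch - 1))).

Lemma runs_assign a e s : scratch < a -> safe N s e -> (deg e <= K)%N ->
  runs (assign a e) s (cost e + (1 + 1)) (upd s a (eval s e)).
Proof.
move=> sa se dK s1 ag; have [ev se'] := eval_agree ag se.
have [s2 [ex2 v2 fr2]] := compile_exec (lexx _) se' dK.
set s3 := upd s2 (scratch - 1) 0.
have v3 : eval_binop Add (s3 scratch) (s3 (scratch - 1)) = eval s e.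
  by rewrite /= /s3 /upd eqxx addr0 v2 ev.
exists (upd s3 a (eval_binop Add (s3 scratch) (s3 (scratch - 1)))); split.
  apply: ExSeq ex2 _; apply: ExSeq; first exact: ExConst.
  by apply: ExOp; rewrite v3; apply: le_word dK _; apply: absz_eval.
move=> b sb; rewrite v3 /upd; case: eqP => // _.
rewrite /s3 /upd gt_eqF; last by apply: lt_trans sb.
by rewrite fr2 // ag.
Qed.

Definition copy (a b : int) : cmd :=
  Seq (Const (scratch - 1) 0) (Op Add a b (scratch - 1)).

Lemma runs_copy a b s : scratch < b -> (`|s b| <= W)%N ->
  runs (copy a b) s (1 + 1) (upd s a (s b)).
Proof.
move=> sb bd s1 ag; set s3 := upd s1 (scratch - 1) 0.
have v3 : eval_binop Add (s3 b) (s3 (scratch - 1)) = s b.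
  by rewrite /= /s3 /upd eqxx addr0 gt_eqF -?ag //; apply: lt_trans sb.
exists (upd s3 a (eval_binop Add (s3 b) (s3 (scratch - 1)))); split.
  by apply: ExSeq; [exact: ExConst | apply: ExOp; rewrite v3].
move=> d sd; rewrite v3 /upd; case: eqP => // _.
by rewrite /s3 /upd gt_eqF ?ag //; apply: lt_trans sd.
Qed.

Lemma runs_write a b s : scratch < a -> scratch < b -> (`|s b| <= W)%N ->
  runs (Write a b) s 1 (upd s (s a) (s b)).
Proof.
move=> sa sb bd s1 ag; exists (upd s1 (s1 a) (s1 b)); split.
  by apply: ExWrite; rewrite -ag.
by move=> d sd; rewrite /upd !ag.
Qed.

Lemma runs_if (a : int) p q s t s' : scratch < a ->
  (if 0 < s a then runs p s t s' else runs q s t s') -> runs (If a p q) s t.+1 s'.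
Proof.
move=> sa h s1 ag; case: ltP h => [pos|neg] /(_ s1 ag) [s2 [ex ag2]]; exists s2; split=> //.
  by apply: ExIfT ex; rewrite -ag.
by apply: ExIfF ex; rewrite -ag.
Qed.

Lemma runs_while_stop (a : int) p s : scratch < a -> s a <= 0 -> runs (While a p) s 1 s.
Proof. by move=> sa h s1 ag; exists s1; split=> //; apply: ExWhileF; rewrite -ag. Qed.

Lemma runs_while_step (a : int) p s t s' t' s'' : scratch < a -> 0 < s a ->
  runs p s t s' -> runs (While a p) s' t' s'' -> runs (While a p) s (t + t').+1 s''.
Proof.
move=> sa h rp rw s1 ag; have [s2 [ex2 ag2]] := rp _ ag; have [s3 [ex3 ag3]] := rw _ ag2.
by exists s3; split=> //; apply: ExWhileT ex2 ex3; rewrite -ag.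
Qed.

End Programs.

Lemma upd_same s a v : upd s a v a = v.
Proof. by rewrite /upd eqxx. Qed.

Lemma upd_other s a v b : b != a -> upd s a v b = s b.
Proof. by rewrite /upd => /negbTE ->. Qed.

Definition Var (a : int) : expr := Get (Lit a).

(** Work cells are negative because the input fills an initial segment of the nonnegative ones; they
    stay above [scratch]. *)
Definition acc_cell : int := -1.
Definition idx_cell : int := -2.
Definition addr_cell : int := -3.
Definition val_cell : int := -4.

(* Cell [5 + 2 m + v] counts the occurrences of label [v]. *)
Definition counter_expr : expr :=
  Bin Add (Bin Add (Lit 5) (Bin Mul (Lit 2) (Var 1))) (Get (Bin Add (Var idx_cell) (Lit 4))).

Definition decr_idx : cmd := assign idx_cell (Bin Defs.Sub (Var idx_cell) (Lit 1)).

Definition clear_body : cmd :=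
  Seq (assign addr_cell counter_expr)
    (Seq (assign val_cell (Lit 0)) (Seq (Write addr_cell val_cell) decr_idx)).

Definition count_body : cmd :=
  Seq (assign addr_cell counter_expr)
    (Seq (assign val_cell (Get (Var addr_cell)))
      (Seq (assign acc_cell (Bin Add (Var acc_cell) (Var val_cell)))
        (Seq (assign val_cell (Bin Add (Var val_cell) (Lit 1)))
          (Seq (Write addr_cell val_cell) decr_idx)))).

(** * The two passes over the edge list *)

Section Loops.
Variables (N K n m c : nat) (ls us : int) (ws : seq nat).
Hypotheses (N8 : (8 <= N)%N) (nN : (n <= N)%N) (cN : (c <= N)%N) (mN : (m <= N ^ 2)%N).
Hypotheses (lsN : (`|ls| <= N)%N) (usN : (`|us| <= N)%N).
Hypotheses (size_ws : size ws = m.*2) (ws_lt : all (fun w => (w < n)%N) ws).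
Hypothesis K100 : (100 <= K)%N.

Let N2 : (2 <= N)%N. Proof. exact: leq_trans N8. Qed.
Local Notation W := (N ^ K)%N.
Local Notation base := (5 + m.*2%:Z).

Definition input (s : Defs.mem) : Prop :=
  [/\ s 0 = n%:Z, s 1 = m%:Z, s 2 = c%:Z, s 3 = ls & s 4 = us]
  /\ forall j, (j < m.*2)%N -> s (5 + j%:Z) = (nth 0%N ws j)%:Z.

Lemma input_upd s a v : a < 0 \/ base <= a -> input s -> input (upd s a v).
Proof.
move=> h [[h0 h1 h2 h3 h4] hw].
have o b : 0 <= b -> b < base -> upd s a v b = s b.
  move=> b0 bb; apply: upd_other; apply/eqP => E; subst b.
  by case: h; [rewrite ltNge b0 | rewrite leNgt bb].
by split; [split; rewrite o // | move=> j jm; rewrite o ?hw //; move: jm; clear; lia].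
Qed.

Lemma ler_pow x k : (x <= N ^ k)%N -> (k <= 6)%N -> (x <= N ^ 6)%N.
Proof. by move=> h k6; apply: leq_trans h _; rewrite leq_pexp2l // ltnW. Qed.

Lemma safe_Lit s (v : nat) : (v <= 8)%N -> safe N s (Lit v%:Z).
Proof.
by move=> v8; apply: (@ler_pow _ 1) => //; rewrite expn1; apply: leq_trans v8 N8.
Qed.

Lemma safe_Var s a : scratch < a -> a <= 8 -> (`|s a| <= N ^ 6)%N -> safe N s (Var a).
Proof.
move=> sa a8 h; split=> //; apply: (@ler_pow _ 2) => //.
have : (8 * 8 <= N * N)%N by apply: leq_mul.
by rewrite -mulnn; move: sa a8; rewrite /scratch; clear; lia.
Qed.

Lemma dbl_le : (m.*2 <= N ^ 3)%N.
Proof. by rewrite expnS -mul2n leq_mul. Qed.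

Lemma label_lt j : (j < m.*2)%N -> (nth 0%N ws j < n)%N.
Proof. by rewrite -size_ws => h; apply: (allP ws_lt); apply: mem_nth. Qed.

Lemma le_pow4 x : (x <= N ^ 3 + N + N)%N -> (x <= N ^ 6)%N.
Proof.
move=> h; apply: (@ler_pow _ 4) => //; apply: leq_trans h _.
have : (N <= N ^ 3)%N by rewrite -{1}[N]expn1 leq_pexp2l // ltnW.
have : (8 * N ^ 3 <= N ^ 4)%N by rewrite [(N ^ 4)%N]expnS leq_mul.
by move: (N ^ 3)%N (N ^ 4)%N => p q; clear; lia.
Qed.

Lemma counter_addr_bound j : (j < m.*2)%N ->
  (`|(base + (nth 0%N ws j)%:Z)%R| <= N ^ 6)%N.
Proof.
move=> /label_lt lt; apply: le_pow4.
by move: lt nN N8 dbl_le; move: (N ^ 3)%N (nth _ _ _) => p q; clear; lia.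
Qed.

Lemma counter_exprP s i : input s -> s idx_cell = i.+1%:Z -> (i < m.*2)%N ->
  eval s counter_expr = base + (nth 0%N ws i)%:Z /\ safe N s counter_expr.
Proof.
move=> [[_ h1 _ _ _] hw] hi im.
(* The index cell is one above the list position, and labels start at cell 5, hence the offset 4. *)
have E : s (s idx_cell + 4) = (nth 0%N ws i)%:Z.
  by rewrite -hw //; congr s; rewrite hi; clear; lia.
split; first by rewrite /= h1 E; congr (_ + _); clear; lia.
split; [split; [exact: (@safe_Lit _ 5)|split; [exact: (@safe_Lit _ 2)|]]|split].
- by apply: safe_Var => //; rewrite h1; apply: (@ler_pow _ 2).
- split; last exact: (@safe_Lit _ 4).
  by apply: safe_Var => //; rewrite hi; apply: le_pow4; move: im dbl_le; move: (N ^ 3)%N => p; clear; lia.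
- by rewrite /= hi /scratch; clear; lia.
- rewrite [eval _ _]/= E; apply: (@ler_pow _ 1) => //; rewrite expn1.
  by apply: leq_trans nN; apply: ltnW; apply: label_lt.
Qed.

Lemma runs_decr s i : s idx_cell = i.+1%:Z -> (i < m.*2)%N ->
  runs N K decr_idx s 6 (upd s idx_cell i%:Z).
Proof.
move=> hi im.
have -> : i%:Z = eval s (Bin Defs.Sub (Var idx_cell) (Lit 1)) by rewrite /= hi; clear; lia.
apply: (runs_assign N2) => //; last by apply: leq_trans K100.
split; last exact: (@safe_Lit _ 1).
apply: safe_Var => //; rewrite hi; apply: le_pow4.
by move: im dbl_le; move: (N ^ 3)%N => p; clear; lia.
Qed.

Lemma word_of x : (x <= N ^ 6)%N -> (x <= W)%N.
Proof. by move=> h; apply: (le_word N2 (k := 6)) => //; apply: leq_trans K100. Qed.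

(** Zero counters stay zero, so labels that occur several times do no harm. *)
Lemma clear_step s i : input s -> s idx_cell = i.+1%:Z -> (i < m.*2)%N ->
  exists s', [/\ runs N K clear_body s 24 s', input s', s' idx_cell = i%:Z,
    s' (base + (nth 0%N ws i)%:Z) = 0 &
    forall b, base <= b -> s b = 0 -> s' b = 0].
Proof.
move=> inp hi im; have [ev sf] := counter_exprP inp hi im.
set a := base + _ in ev *.
have a0 : base <= a by rewrite lerDl.
have ap : 0 <= a by apply: le_trans a0.
pose s1 := upd s addr_cell a; pose s2 := upd s1 val_cell 0; pose s3 := upd s2 a 0.
have nc (b d : int) : d < 0 -> 0 <= b -> b != d.
  by move=> d0 b0; apply/eqP => E; subst b; move: (lt_le_trans d0 b0); rewrite ltxx.
have s3i : s3 idx_cell = i.+1%:Z.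
  by rewrite /s3 upd_other; [rewrite /s2 upd_other // /s1 upd_other | rewrite eq_sym nc].
exists (upd s3 idx_cell i%:Z); split.
- apply: (@runs_seq _ _ _ _ _ 14 s1 10).
    by rewrite /s1 -ev; apply: (runs_assign N2) => //; apply: leq_trans K100.
  apply: (@runs_seq _ _ _ _ _ 3 s2 7).
    by apply: (runs_assign N2) => //; apply: leq_trans K100.
  apply: (@runs_seq _ _ _ _ _ 1 s3 6); last exact: runs_decr.
  have h2a : s2 addr_cell = a by rewrite /s2 upd_other // /s1 upd_same.
  have h2v : s2 val_cell = 0 by rewrite /s2 upd_same.
  by have := @runs_write N K addr_cell val_cell s2; rewrite h2a h2v; apply.
- have i1 : input s1 by apply: input_upd inp; left.
  have i2 : input s2 by apply: input_upd i1; left.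
  have i3 : input s3 by apply: input_upd i2; right.
  by apply: input_upd i3; left.
- by rewrite upd_same.
- by rewrite upd_other ?nc // /s3 upd_same.
- move=> b bb sb; have b0 : 0 <= b by apply: le_trans bb.
  rewrite upd_other ?nc // /s3 /upd; case: eqP => // _.
  by rewrite -/s2 /s2 upd_other ?nc // /s1 upd_other ?nc.
Qed.

Lemma count_step s i p k : input s -> s idx_cell = i.+1%:Z -> (i < m.*2)%N ->
  s acc_cell = p%:Z -> (p <= N ^ 6)%N ->
  s (base + (nth 0%N ws i)%:Z) = k%:Z -> (k <= m.*2)%N ->
  exists s', [/\ runs N K count_body s 39 s', input s', s' idx_cell = i%:Z,
    s' acc_cell = (p + k)%:Z &
    forall b, base <= b ->
      s' b = if b == base + (nth 0%N ws i)%:Z then k.+1%:Z else s b].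
Proof.
move=> inp hi im hp pN hk km; have [ev sf] := counter_exprP inp hi im.
have aN := counter_addr_bound im.
set a := base + _ in ev hk aN *.
have a0 : base <= a by rewrite lerDl.
have ap : 0 <= a by apply: le_trans a0.
have sa : scratch < a by apply: lt_le_trans ap.
have kN : (k <= N ^ 6)%N.
  by apply: le_pow4; move: km dbl_le; move: (N ^ 3)%N => q; clear; lia.
have k1N : (k.+1 <= N ^ 6)%N.
  by apply: le_pow4; move: km dbl_le N8; move: (N ^ 3)%N => q; clear; lia.
have nc (b d : int) : d < 0 -> 0 <= b -> b != d.
  by move=> d0 b0; apply/eqP => E; subst b; move: (lt_le_trans d0 b0); rewrite ltxx.
have cn' (b d : int) : d < 0 -> 0 <= b -> d != b by move=> *; rewrite eq_sym nc.
have KD e : (deg e <= 100)%N -> (deg e <= K)%N by move=> h; apply: leq_trans h K100.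
pose s1 := upd s addr_cell a; pose s2 := upd s1 val_cell k%:Z.
pose s3 := upd s2 acc_cell (p + k)%:Z; pose s4 := upd s3 val_cell k.+1%:Z.
pose s5 := upd s4 a k.+1%:Z.
have s1a : s1 addr_cell = a by rewrite /s1 upd_same.
have s1c : s1 a = k%:Z by rewrite /s1 upd_other ?hk ?nc.
have s2v : s2 val_cell = k%:Z by rewrite /s2 upd_same.
have s2p : s2 acc_cell = p%:Z by rewrite /s2 upd_other // /s1 upd_other.
have s3v : s3 val_cell = k%:Z by rewrite /s3 upd_other.
have s4v : s4 val_cell = k.+1%:Z by rewrite /s4 upd_same.
have s4a : s4 addr_cell = a.
  by rewrite /s4 upd_other // /s3 upd_other // /s2 upd_other.
have s5i : s5 idx_cell = i.+1%:Z.
  by rewrite /s5 upd_other ?cn' // /s4 upd_other // /s3 upd_other // /s2 upd_other.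
have sfa : safe N s1 (Var addr_cell) by apply: safe_Var => //; rewrite s1a.
exists (upd s5 idx_cell i%:Z); split.
- apply: (@runs_seq _ _ _ _ _ 14 s1 25).
    by rewrite /s1 -ev; apply: (runs_assign N2) => //; apply: KD.
  apply: (@runs_seq _ _ _ _ _ 5 s2 20).
    have -> : s2 = upd s1 val_cell (eval s1 (Get (Var addr_cell))).
      by rewrite /= s1a s1c.
    apply: (runs_assign N2) => //; last exact: KD.
    by split=> //; rewrite /= s1a ?s1c.
  apply: (@runs_seq _ _ _ _ _ 7 s3 13).
    have -> : s3 = upd s2 acc_cell (eval s2 (Bin Add (Var acc_cell) (Var val_cell))).
      by rewrite /= s2p s2v.
    apply: (runs_assign N2) => //; last exact: KD.
    by split; apply: safe_Var; rewrite ?s2p ?s2v.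
  apply: (@runs_seq _ _ _ _ _ 6 s4 7).
    have -> : s4 = upd s3 val_cell (eval s3 (Bin Add (Var val_cell) (Lit 1))).
      by rewrite /= s3v /s4 -addn1.
    apply: (runs_assign N2) => //; last exact: KD.
    by split; [apply: safe_Var; rewrite ?s3v | exact: (@safe_Lit _ 1)].
  apply: (@runs_seq _ _ _ _ _ 1 s5 6); last exact: runs_decr.
  by have := @runs_write N K addr_cell val_cell s4; rewrite s4a s4v; apply=> //; apply: word_of.
- have i1 : input s1 by apply: input_upd inp; left.
  have i2 : input s2 by apply: input_upd i1; left.
  have i3 : input s3 by apply: input_upd i2; left.
  have i4 : input s4 by apply: input_upd i3; left.
  have i5 : input s5 by apply: input_upd i4; right.
  by apply: input_upd i5; left.
- by rewrite upd_same.
- by rewrite upd_other // /s5 upd_other ?cn' // /s4 upd_other // /s3 upd_same.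
- move=> b bb; have b0 : 0 <= b by apply: le_trans bb.
  rewrite upd_other ?nc // /s5 {1}/upd; case: eqP => // _.
  rewrite /s4 upd_other ?nc // /s3 upd_other ?nc // /s2 upd_other ?nc //.
  by rewrite /s1 upd_other ?nc.
Qed.

Lemma clear_loop i s : input s -> s idx_cell = i%:Z -> (i <= m.*2)%N ->
  exists s', [/\ runs N K (While idx_cell clear_body) s (25 * i + 1) s', input s',
    (forall j, (j < i)%N -> s' (base + (nth 0%N ws j)%:Z) = 0) &
    forall b, base <= b -> s b = 0 -> s' b = 0].
Proof.
elim: i s => [|i IH] s inp hi im.
  by exists s; split=> //; apply: runs_while_stop; rewrite ?hi.
have [s1 [r1 in1 hi1 z1 p1]] := clear_step inp hi im.
have [s2 [r2 in2 z2 p2]] := IH s1 in1 hi1 (ltnW im).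
exists s2; split=> //.
- have -> : (25 * i.+1 + 1 = (24 + (25 * i + 1)).+1)%N by clear; lia.
  by apply: runs_while_step r1 r2; rewrite ?hi.
- move=> j; rewrite ltnS leq_eqVlt => /predU1P[->|]; last exact: z2.
  by apply: p2; rewrite // lerDl.
- by move=> b bb sb; apply: p2 => //; apply: p1.
Qed.

Lemma equal_pairs_le (X : eqType) (w : seq X) : (equal_pairs w <= size w ^ 2)%N.
Proof.
elim: w => //= x w IH; have := count_size (pred1 x) w; move: IH.
by rewrite -!mulnn; move: (count _ w) (equal_pairs w) (size w); clear; nia.
Qed.

(** The invariant is that each counter holds a multiplicity in [drop i ws]. When position [i] joins
    this suffix, the counter of its label is the term that [equal_pairs] adds. *)
Lemma count_loop i s : input s -> s idx_cell = i%:Z -> (i <= m.*2)%N ->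
  s acc_cell = (equal_pairs (drop i ws))%:Z ->
  (forall j, (j < m.*2)%N ->
     s (base + (nth 0%N ws j)%:Z) = (count_mem (nth 0%N ws j) (drop i ws))%:Z) ->
  exists s', [/\ runs N K (While idx_cell count_body) s (40 * i + 1) s', input s' &
    s' acc_cell = (equal_pairs ws)%:Z].
Proof.
elim: i s => [|i IH] s inp hi im hp hc.
  exists s; split=> //; last by rewrite hp drop0.
  by apply: runs_while_stop; rewrite ?hi.
have iw : (i < size ws)%N by rewrite size_ws.
have Dd : drop i ws = nth 0%N ws i :: drop i.+1 ws by rewrite -drop_nth.
have sd : (size (drop i.+1 ws) <= m.*2)%N by rewrite size_drop size_ws leq_subr.
have [||s1 [r1 in1 hi1 p1 c1]] := count_step inp hi im hp _ (hc i im).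
- apply: leq_trans (equal_pairs_le _) _; rewrite (expnM N 3 2) leq_exp2r //.
  by apply: leq_trans sd dbl_le.
- by apply: leq_trans (count_size _ _) sd.
have [||s2 [r2 in2 p2]] := IH s1 in1 hi1 (ltnW im).
- by rewrite p1 Dd /= addnC.
- move=> j jm; rewrite c1 ?lerDl // (hc j jm) Dd /= eq_sym.
  rewrite (inj_eq (addrI _)) eqz_nat; case: eqP => // ->.
  by rewrite add1n.
exists s2; split=> //.
have -> : (40 * i.+1 + 1 = (39 + (40 * i + 1)).+1)%N by clear; lia.
by apply: runs_while_step r1 r2; rewrite ?hi.
Qed.

End Loops.

(* With S1 = A / D and 2 S2 = B / D, the bounds are (B + A) / A,
   (B + A - A ls) / (A - ls D) and (A us - B - A) / (us D - A). *)
Definition lower1_int (A B : int) : int := - ((- (B + A)) %/ A)%Z.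
Definition lower2_int (A B D ls : int) : int :=
  - ((- (B + A - A * ls)) %/ (A - ls * D))%Z.
Definition upper_int (A B D us : int) : int := ((A * us - B - A) %/ (us * D - A))%Z.

Section RoundedBounds.
Variables (T : finType) (G : graph T) (c P : nat).
Hypotheses (c4 : (4 <= c)%N) (cn : (c + 4 <= #|T|)%N).
Hypotheses (nc : ~ complete G) (ncc : ~ cocomplete G).
Hypothesis DP : sum_deg_sqr G = (P.*2 + (gsize G).*2)%N.

Let A := S1_num #|T|%:Z (gsize G)%:Z c%:Z.
Let B := S2_num #|T|%:Z (gsize G)%:Z c%:Z P%:Z.
Let D := falling4 #|T|%:Z.

Let D0 : (0 : rat) < D%:~R.
Proof. by rewrite ltr0z; apply: falling4_gt0 c4 cn. Qed.

Let S1E : A%:~R = S1 G c * D%:~R.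
Proof. by rewrite (S1_ratio G c4 cn) mulfVK // gt_eqF. Qed.

Let S2E : B%:~R = 2%:R * S2 G c * D%:~R.
Proof. by rewrite (S2_ratio c4 cn DP) mulfVK // gt_eqF. Qed.

Let S1p : 0 < S1 G c. Proof. exact: S1_gt0. Qed.

Lemma ceil_first_term : Num.ceil (2%:R * S2 G c / S1 G c + 1) = lower1_int A B.
Proof.
rewrite /lower1_int -ceil_div; last by rewrite -(ltr0z rat) S1E mulr_gt0.
rewrite intrD S1E S2E; congr Num.ceil; field.
by rewrite !gt_eqF.
Qed.

Lemma ceil_second_term (ls : int) : ls <= (min_size G c)%:Z ->
  Num.ceil (S1 G c + variance G c / (S1 G c - ls%:~R)) = lower2_int A B D ls.
Proof.
move=> lsm; have lsS : 0 < S1 G c - ls%:~R.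
  rewrite subr_gt0; apply: le_lt_trans (min_lt_S1 c4 cn nc ncc).
  by rewrite -(ler_int rat) in lsm.
rewrite /lower2_int; move: (S1E) (S2E) (D0); move: (A) (B) (D) => a b d aE bE d0.
have E : (a - ls * d)%:~R = (S1 G c - ls%:~R) * d%:~R :> rat.
  by rewrite intrB intrM aE mulrBl.
rewrite -ceil_div; last by rewrite -(ltr0z rat) E mulr_gt0.
rewrite E intrB intrD intrM aE bE (varianceE G cn); congr Num.ceil; field.
by rewrite !gt_eqF.
Qed.

Lemma floor_upper (us : int) : (max_size G c)%:Z <= us ->
  Num.floor (upper G c us) = upper_int A B D us.
Proof.
move=> usm; have usS : 0 < us%:~R - S1 G c.
  rewrite subr_gt0; apply: lt_le_trans (S1_lt_max c4 cn nc ncc) _.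
  by rewrite -(ler_int rat) in usm.
rewrite /upper_int; move: (S1E) (S2E) (D0); move: (A) (B) (D) => a b d aE bE d0.
have E : (us * d - a)%:~R = (us%:~R - S1 G c) * d%:~R :> rat.
  by rewrite intrB intrM aE mulrBl.
rewrite -floor_div; last by rewrite -(ltr0z rat) E mulr_gt0.
rewrite E !intrB intrM aE bE /upper (varianceE G cn); congr Num.floor; field.
by rewrite !gt_eqF.
Qed.

End RoundedBounds.

(** * Evaluation and output of the bounds *)

Fixpoint input_expr (e : expr) : bool :=
  match e with
  | Lit v => (`|v| <= 8)%N
  | Get (Lit a) => a \in [:: acc_cell; 0; 1; 2; 3; 4]
  | Get _ => false
  | Bin _ e1 e2 => input_expr e1 && input_expr e2
  end.

(** Expressions of this class read only the input parameters and the pair count, so results stored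
    earlier in other cells do not affect them. *)
Lemma input_expr_eval N s s' e : (8 <= N)%N -> input_expr e ->
  {in [:: acc_cell; 0; 1; 2; 3; 4], forall a, s' a = s a /\ (`|s a| <= N ^ 6)%N} ->
  eval s' e = eval s e /\ safe N s' e.
Proof.
move=> N8 + h.
have N6 : (8 <= N ^ 6)%N.
  by apply: leq_trans (N8) _; rewrite -{1}[N]expn1 leq_pexp2l // (leq_trans _ N8).
elim: e => [v|[a|e|o e1 e2] _|o e1 IH1 e2 IH2] //=.
- by move=> v8; split=> //; apply: leq_trans N6.
- move=> ain; have [-> bd] := h a ain; split=> //.
  have [/andP[lo hi]] : (scratch < a) && (`|a| <= 8)%N.
    by move: ain; rewrite !inE => /or4P[| | |/orP[|/orP[|]]] /eqP ->.
  by split=> //; apply: leq_trans N6.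
- by case/andP=> /IH1[-> ?] /IH2[-> ?].
Qed.

Local Notation sub := (Bin Defs.Sub).
Local Notation mul := (Bin Mul).
Local Notation add := (Bin Add).

Definition falling4_expr : expr :=
  mul (mul (mul (Var 0) (sub (Var 0) (Lit 1))) (sub (Var 0) (Lit 2))) (sub (Var 0) (Lit 3)).

Definition S1_expr : expr :=
  mul (mul (Var 1) (mul (Var 2) (sub (Var 2) (Lit 1))))
    (mul (sub (Var 0) (Lit 2)) (sub (Var 0) (Lit 3))).

Definition S2_expr : expr :=
  let p2 := mul (Lit 2) (Var acc_cell) in
  mul (mul (mul (Var 2) (sub (Var 2) (Lit 1))) (sub (Var 2) (Lit 2)))
    (add (mul p2 (sub (Var 0) (Lit 3)))
       (mul (sub (mul (Var 1) (sub (Var 1) (Lit 1))) p2) (sub (Var 2) (Lit 3)))).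

Definition neg_expr (e : expr) : expr := sub (Lit 0) e.

Definition lower1_expr : expr :=
  neg_expr (Bin Div (neg_expr (add S2_expr S1_expr)) S1_expr).

Definition lower2_expr : expr :=
  neg_expr (Bin Div (neg_expr (sub (add S2_expr S1_expr) (mul S1_expr (Var 3))))
    (sub S1_expr (mul (Var 3) falling4_expr))).

Definition upper_expr : expr :=
  Bin Div (sub (sub (mul S1_expr (Var 4)) S2_expr) S1_expr)
    (sub (mul (Var 4) falling4_expr) S1_expr).

(** The output cells 0, 1, 2 also hold the inputs n, m, c, so all values are computed into work
    cells, free after the loops, before any output is written. Cell -5 decides which lower term is
    the minimum. *)
Definition output_cmd : cmd :=
  Seq (assign (-2) lower1_expr)
    (Seq (assign (-3) lower2_expr)
      (Seq (assign (-4) upper_expr)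
        (Seq (assign (-5) (sub lower2_expr lower1_expr))
          (Seq (If (-5) (Seq (copy 0 (-2)) (copy 1 (-3))) (Seq (copy 0 (-3)) (copy 1 (-2))))
            (copy 2%:Z (-4)))))).

Definition bounds_cmd : cmd :=
  let set_idx := assign idx_cell (mul (Lit 2) (Var 1)) in
  Seq set_idx (Seq (While idx_cell clear_body)
    (Seq (assign acc_cell (Lit 0)) (Seq set_idx
      (Seq (While idx_cell count_body) output_cmd)))).

(* Serves both as the exponent of the word size and as the slope of the running
   time. *)
Definition word_exp : nat := 2000.

Section Output.
Variables (N n m c P : nat) (ls us : int) (ws : seq nat).
Hypotheses (N8 : (8 <= N)%N) (nN : (n <= N)%N) (cN : (c <= N)%N) (mN : (m <= N ^ 2)%N).
Hypotheses (lsN : (`|ls| <= N)%N) (usN : (`|us| <= N)%N) (PN : (P <= N ^ 6)%N).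

Let A := S1_num n%:Z m%:Z c%:Z.
Let B := S2_num n%:Z m%:Z c%:Z P%:Z.
Let D := falling4 n%:Z.

Lemma eval_lower1 s : input n m c ls us ws s -> s acc_cell = P%:Z ->
  eval s lower1_expr = lower1_int A B.
Proof. by case=> [[h0 h1 h2 h3 h4] _] hp; rewrite /= h0 h1 h2 hp !sub0r. Qed.

Lemma eval_lower2 s : input n m c ls us ws s -> s acc_cell = P%:Z ->
  eval s lower2_expr = lower2_int A B D ls.
Proof. by case=> [[h0 h1 h2 h3 h4] _] hp; rewrite /= h0 h1 h2 h3 hp !sub0r. Qed.

Lemma eval_upper s : input n m c ls us ws s -> s acc_cell = P%:Z ->
  eval s upper_expr = upper_int A B D us.
Proof. by case=> [[h0 h1 h2 h3 h4] _] hp; rewrite /= h0 h1 h2 h4 hp. Qed.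

Lemma output_runs s : input n m c ls us ws s -> s acc_cell = P%:Z ->
  exists t s', [/\ runs N word_exp output_cmd s t s', (t <= 1000)%N,
    s' 0 = Num.min (lower1_int A B) (lower2_int A B D ls),
    s' 1 = Num.max (lower1_int A B) (lower2_int A B D ls) &
    s' 2%:Z = upper_int A B D us].
Proof.
move=> inp hp; have N2 : (2 <= N)%N by apply: leq_trans N8.
rewrite -(eval_lower1 inp hp) -(eval_lower2 inp hp) -(eval_upper inp hp).
have vars : {in [:: acc_cell; 0; 1; 2; 3; 4], forall a, (`|s a| <= N ^ 6)%N}.
  have [[h0 h1 h2 h3 h4] _] := inp.
  have small x k : (k <= 6)%N -> (x <= N ^ k)%N -> (x <= N ^ 6)%N.
    by move=> k6 /leq_trans; apply; rewrite leq_pexp2l // ltnW.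
  move=> a; rewrite !inE => /or4P[| | |/orP[|/orP[|]]] /eqP ->.
  - by rewrite hp.
  - by rewrite h0; apply: (small _ 1).
  - by rewrite h1; apply: (small _ 2).
  - by rewrite h2; apply: (small _ 1).
  - by rewrite h3; apply: (small _ 1).
  - by rewrite h4; apply: (small _ 1).
have step a e s0 : a \in [:: -2; -3; -4; -5] -> input_expr e -> (deg e <= word_exp)%N ->
    {in [:: acc_cell; 0; 1; 2; 3; 4], forall b, s0 b = s b} ->
    runs N word_exp (assign a e) s0 (cost e + 2) (upd s0 a (eval s e)) /\
    {in [:: acc_cell; 0; 1; 2; 3; 4], forall b, upd s0 a (eval s e) b = s b}.
  move=> ain ie de same.
  have [|ev sf] := @input_expr_eval N s s0 e N8 ie.
    by move=> b bin; rewrite same // vars.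
  split.
    rewrite -ev; apply: (runs_assign N2) => //.
    by move: ain; rewrite !inE => /or4P[] /eqP ->.
  move=> b bin; rewrite upd_other ?same //.
  move: ain bin; rewrite !inE => /or4P[] /eqP -> /or4P[| | |/orP[|/orP[|]]] /eqP ->; by [].
have d1 : (deg lower1_expr <= word_exp)%N by vm_compute.
have d2 : (deg lower2_expr <= word_exp)%N by vm_compute.
have d3 : (deg upper_expr <= word_exp)%N by vm_compute.
have d4 : (deg (sub lower2_expr lower1_expr) <= word_exp)%N by vm_compute.
have [//|//|//|//|r1 k1] := step (-2) lower1_expr s.
set s1 := upd s _ _ in r1 k1.
have [//|//|//|//|r2 k2] := step (-3) lower2_expr s1.
set s2 := upd s1 _ _ in r2 k2.
have [//|//|//|//|r3 k3] := step (-4) upper_expr s2.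
set s3 := upd s2 _ _ in r3 k3.
have [//|//|//|//|r4 k4] := step (-5) (sub lower2_expr lower1_expr) s3.
set s4 := upd s3 _ _ in r4 k4.
have bound e : input_expr e -> (deg e <= word_exp)%N -> (`|eval s e| <= N ^ word_exp)%N.
  move=> ie de; apply: (le_word N2 de); apply: absz_eval => //.
  by have [] := @input_expr_eval N s s e N8 ie (fun a ha => conj erefl (vars a ha)).
have b1 := bound lower1_expr isT d1; have b2 := bound lower2_expr isT d2.
have b3 := bound upper_expr isT d3.
have e4 : s4 (-5) = eval s lower2_expr - eval s lower1_expr by rewrite /s4 upd_same.
have f1 : s4 (-2) = eval s lower1_expr.
  by rewrite /s4 upd_other // /s3 upd_other // /s2 upd_other // /s1 upd_same.
have f2 : s4 (-3) = eval s lower2_expr.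
  by rewrite /s4 upd_other // /s3 upd_other // /s2 upd_same.
have f3 : s4 (-4) = eval s upper_expr by rewrite /s4 upd_other // /s3 upd_same.
have C : (cost lower1_expr + 2 + (cost lower2_expr + 2 + (cost upper_expr + 2 +
    (cost (sub lower2_expr lower1_expr) + 2 + ((1 + 1 + (1 + 1)).+1 + (1 + 1))))) <= 1000)%N.
  by vm_compute.
move: b1 b2 b3 r1 r2 r3 r4 e4 f1 f2 f3 C.
move: (eval s lower1_expr) (eval s lower2_expr) (eval s upper_expr) => l1 l2 up.
move: (cost lower1_expr) (cost lower2_expr) (cost upper_expr) (cost (sub _ _)) => t1 t2 t3 t4.
move=> b1 b2 b3 r1 r2 r3 r4 e4 f1 f2 f3 C.
pose s5 := upd (upd s4 0 (Num.min l1 l2)) 1 (Num.max l1 l2).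
have r5 : runs N word_exp (If (-5) (Seq (copy 0 (-2)) (copy 1 (-3))) (Seq (copy 0 (-3)) (copy 1 (-2))))
    s4 (1 + 1 + (1 + 1)).+1 s5.
  apply: runs_if => //; rewrite e4 subr_gt0 /s5; case: (ltP l1 l2) => _.
    apply: (@runs_seq _ _ _ _ _ _ (upd s4 0 l1)).
      by rewrite -f1; apply: runs_copy; rewrite ?f1.
    have := @runs_copy N word_exp 1 (-3) (upd s4 0 l1).
    by rewrite upd_other // f2; apply.
  apply: (@runs_seq _ _ _ _ _ _ (upd s4 0 l2)).
    by rewrite -f2; apply: runs_copy; rewrite ?f2.
  have := @runs_copy N word_exp 1 (-2) (upd s4 0 l2).
  by rewrite upd_other // f1; apply.
have r6 : runs N word_exp (copy 2%:Z (-4)) s5 (1 + 1) (upd s5 2%:Z up).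
  have := @runs_copy N word_exp 2%:Z (-4) s5; rewrite /s5 upd_other // upd_other // f3; exact.
exists (t1 + 2 + (t2 + 2 + (t3 + 2 + (t4 + 2 + ((1 + 1 + (1 + 1)).+1 + (1 + 1))))))%N.
exists (upd s5 2%:Z up); split=> //.
by apply: runs_seq r1 (runs_seq r2 (runs_seq r3 (runs_seq r4 (runs_seq r5 r6)))).
Qed.

End Output.

Lemma gsize_le (T : finType) (G : graph T) : (gsize G <= #|T| ^ 2)%N.
Proof.
have -> : gsize G = size_in G [set: T].
  by apply: eq_card => e; rewrite in_set subsetT andbT.
apply: leq_trans (size_in_le _ _) _; rewrite cardsT bin2 -mulnn.
by rewrite -divn2; apply: leq_trans (leq_div _ _) _; rewrite leq_mul2l leq_pred orbT.
Qed.

Lemma gsize_gt0 (T : finType) (G : graph T) : ~ cocomplete G -> (0 < gsize G)%N.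
Proof.
move=> ncc; rewrite lt0n; apply/negP => /eqP/cards0_eq E; apply: ncc => x y xy.
rewrite /= /compl_adj /= xy /=; apply/negP => Gxy.
by have := edges_set2 G x y; rewrite E Gxy inE.
Qed.

Lemma loaded_input (T : finType) (G : graph T) (lab : T -> 'I_#|T|) es c ls us s :
  edge_list G es -> loaded (input_words G lab es c ls us) s ->
  input #|T| (gsize G) c ls us [seq (lab v : nat) | v <- endpoints es] s.
Proof.
move=> esG; have sz := size_endpoints esG.
have -> : input_words G lab es c ls us = [:: #|T|%:Z; (gsize G)%:Z; c%:Z; ls; us] ++
    [seq (lab v : nat)%:Z | v <- endpoints es].
  by congr cat; rewrite /endpoints; elim: es {esG sz} => //= e es' ->.
move=> L; have Lt k : (k < 5)%N -> s k%:Z = nth 0 [:: #|T|%:Z; (gsize G)%:Z; c%:Z; ls; us] k.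
  by move=> k5; rewrite L ?nth_cat ?k5 // size_cat; apply: leq_trans k5 (leq_addr _ _).
split; first by split; [exact: (Lt 0)|exact: (Lt 1)|exact: (Lt 2)|exact: (Lt 3)|exact: (Lt 4)].
move=> j jm; have -> : 5 + j%:Z = (5 + j)%N%:Z by [].
rewrite L; last by rewrite size_cat size_map sz /= ltn_add2l.
rewrite nth_cat ltnNge leq_addr /= addKn (map_comp Posz).
by rewrite (nth_map 0%N) // size_map sz.
Qed.

Lemma set_idx_runs N n m c ls us ws s : (8 <= N)%N -> (m <= N ^ 2)%N ->
  input n m c ls us ws s ->
  runs N word_exp (assign idx_cell (mul (Lit 2) (Var 1))) s 6 (upd s idx_cell m.*2%:Z).
Proof.
move=> N8 mN [[_ h1 _ _ _] _]; have N2 : (2 <= N)%N by apply: leq_trans N8.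
have -> : m.*2%:Z = eval s (mul (Lit 2) (Var 1)) by rewrite /= h1; clear; lia.
apply: (runs_assign N2) => //; split; first exact: (@safe_Lit N N8 s 2).
by apply: safe_Var => //; rewrite h1; apply: leq_trans mN _; rewrite leq_pexp2l // ltnW.
Qed.

Lemma bounds_computable : computes_bounds bounds_cmd word_exp.
Proof.
move=> T G c ls us lab es s nc ncc c4 cn' lsm usm labI esG /(loaded_input esG) inp.
have cn : (c + 4 <= #|T|)%N by move: c4 cn'; clear; lia.
set ws := map _ _ in inp; set m := gsize G in inp *; set n := #|T| in inp *.
pose P := equal_pairs ws.
have DP : sum_deg_sqr G = (P.*2 + m.*2)%N.
  rewrite (sum_deg_sqr_pairs esG) /P equal_pairs_map // => x y /val_inj; exact: labI.
pose N := (n + `|us| + `|ls|)%N.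
have n8 : (8 <= n)%N by apply: leq_trans cn; rewrite (leq_add2r 4 4).
have nN : (n <= N)%N by rewrite /N -addnA leq_addr.
have N8 : (8 <= N)%N by apply: leq_trans n8 nN.
have N2 : (2 <= N)%N by apply: leq_trans N8.
have cN : (c <= N)%N by apply: leq_trans nN; apply: c_le_card cn.
have mN : (m <= N ^ 2)%N by apply: leq_trans (gsize_le G) _; rewrite leq_exp2r.
have lsN : (`|ls| <= N)%N by rewrite leq_addl.
have usN : (`|us| <= N)%N by rewrite /N addnAC leq_addl.
have size_ws : size ws = m.*2 by rewrite size_map (size_endpoints esG).
have ws_lt : all (fun w => (w < n)%N) ws by apply/allP => w /mapP[v _ ->].
have K100 : (100 <= word_exp)%N by vm_compute.
have PN : (P <= N ^ 6)%N.
  apply: leq_trans (equal_pairs_le _) _; rewrite size_ws (expnM N 3 2) leq_exp2r //.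
  exact: dbl_le.
have r1 := set_idx_runs N8 mN inp.
set s1 := upd s _ _ in r1.
have i1 : input n m c ls us ws s1 by apply: input_upd inp; left.
have [s2 [r2 i2 z2 _]] :=
  clear_loop N8 nN mN size_ws ws_lt K100 i1 (upd_same _ _ _) (leqnn _).
have r3 : runs N word_exp (assign acc_cell (Lit 0)) s2 3 (upd s2 acc_cell 0).
  by apply: (runs_assign N2 (e := Lit 0)).
set s3 := upd s2 _ _ in r3.
have i3 : input n m c ls us ws s3 by apply: input_upd i2; left.
have r4 := set_idx_runs N8 mN i3.
set s4 := upd s3 _ _ in r4.
have i4 : input n m c ls us ws s4 by apply: input_upd i3; left.
have drop_ws : drop m.*2 ws = [::] by rewrite -size_ws drop_size.
have acc4 : s4 acc_cell = (equal_pairs (drop m.*2 ws))%:Z.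
  by rewrite drop_ws /s4 upd_other // /s3 upd_same.
have cnt4 j : (j < m.*2)%N ->
    s4 (5 + m.*2%:Z + (nth 0%N ws j)%:Z) = (count_mem (nth 0%N ws j) (drop m.*2 ws))%:Z.
  by move=> jm; rewrite drop_ws /s4 upd_other // /s3 upd_other // z2.
have [s5 [r5 i5 acc5]] :=
  count_loop N8 nN mN size_ws ws_lt K100 i4 (upd_same _ _ _) (leqnn _) acc4 cnt4.
have [t [s6 [r6 tb o0 o1 o2]]] := output_runs N8 nN cN mN lsN usN PN i5 acc5.
have [s7 [ex ag]] :=
  runs_seq r1 (runs_seq r2 (runs_seq r3 (runs_seq r4 (runs_seq r5 r6)))) (agree_refl s).
exists (6 + (25 * m.*2 + 1 + (3 + (6 + (40 * m.*2 + 1 + t)))))%N, s7.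
have E1 := ceil_first_term c4 cn nc ncc DP.
have E2 := ceil_second_term c4 cn nc ncc DP lsm.
split.
- exact: ex.
(* The total is at most [130 m + 1017], and [m >= 1] absorbs the constant. *)
- by have := gsize_gt0 ncc; rewrite -/m; move: tb; rewrite /word_exp; clear; lia.
- by rewrite -ag // o0 /lower_min ceil_min E1 E2.
- by rewrite -ag // o1 /lower_max ceil_max E1 E2.
- by rewrite -ag // o2 (floor_upper c4 cn nc ncc DP usm).
Qed.

Theorem theorem7 :
  (forall (T : finType) (G : graph T) (c : nat),
    ~ complete G -> ~ cocomplete G -> (4 <= c)%N -> (c <= #|T| - 4)%N ->
    (* the bounds *)
    (forall ls us : int,
       0 <= ls -> ls <= (min_size G c)%:Z ->
       (min_size G c <= max_size G c)%N -> (max_size G c)%:Z <= us ->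
       [/\ has_subgraph_ge G c (Num.ceil (lower_min G c ls)),
           has_subgraph_ge G c (Num.ceil (lower_max G c ls))
         & has_subgraph_le G c (Num.floor (upper G c us))])
    /\ variance G c = 2%:R * S2 G c - S1 G c * (S1 G c - 1)
    (* graphs attaining the bounds *)
    /\ ((max_size G c)%:R = lower_max G c (min_size G c)%:Z <-> extremal G)
    /\ ((max_size G c)%:R = lower_min G c (min_size G c)%:Z <->
          is_star G \/ is_single_edge G)
    /\ ((min_size G c)%:R = upper G c (max_size G c)%:Z <-> extremal G)
    (* choice of us *)
    /\ ((max_size G c <= gamma G c)%N
        /\ has_subgraph_le G c (Num.floor (upper G c (gamma G c)%:Z)))
    (* choice of ls *)
    /\ (forall a : nat, (independence_number G <= a)%N ->
          [/\ c%:Z - a%:Z <= (min_size G c)%:Z,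
              has_subgraph_ge G c (Num.ceil (lower_min G c (c%:Z - a%:Z)))
            & has_subgraph_ge G c (Num.ceil (lower_max G c (c%:Z - a%:Z)))]))
  (* the bounds are computable in linear time *)
  /\ (exists (p : cmd) (K : nat), computes_bounds p K).
Proof.
split; last by exists bounds_cmd, word_exp; apply: bounds_computable.
move=> T G c nc ncc c4 cn'.
have cn : (c + 4 <= #|T|)%N by move: c4 cn'; clear; lia.
have low ls := subgraph_lower c4 cn nc ncc (ls := ls).
have upp us := subgraph_upper c4 cn nc ncc (us := us).
have [lmin lmax] := lower_minE c4 cn nc ncc (ls := (min_size G c)%:Z) isT (lexx _).
have gam : (max_size G c <= gamma G c)%N.
  by have [A [cA <-]] := max_size_attained G cn; rewrite -cA size_in_le_gamma.
split; [|split; [|split; [|split; [|split; [|split]]]]].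
- by move=> ls us ls0 lsm _ usm; have [? ?] := low ls lsm; split=> //; apply: upp.
- exact: varianceE.
- by rewrite lmax (lower_bound_eq c4 cn nc ncc) //; apply: two_sizes_extremal.
- by rewrite lmin (lower_bound_eq c4 cn nc ncc) //; apply: zero_or_max_star.
- by rewrite (upper_bound_eq c4 cn nc ncc) //; apply: two_sizes_extremal.
- by split=> //; apply: upp; rewrite lez_nat.
- move=> a ia; have ca : c%:Z - a%:Z <= (min_size G c)%:Z.
    have [A [cA eA]] := min_size_attained G cn.
    by have := card_le_independence G A; rewrite cA eA; move: ia; clear; lia.
  by have [? ?] := low _ ca.
Qed.
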